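(* Consider the CTMDP model described in the context and suppose Condition 1 holds. Let $\pi=(\pi_n)\in\Pi$ be a feasible policy with a finite value such that for each $n=0,1,\dots$, $\pi_{n+1}(da|x_0,\theta_1,\dots,x_n,s)=\delta_{\psi^\ast(x_n)}(da)$ whenever $x_n\in\zeta^c$. Let $\varphi_\pi$ be a stationary policy such that $\eta^\pi_\gamma(dx\times da)=\varphi_\pi(da|x)\eta^\pi_\gamma(dx\times A)$ on $\mathcal B(\zeta\times A)$ and $\varphi_\pi(da|x)=\delta_{\psi^\ast(x)}(da)$ for all $x\in\zeta^c$. Then for each $i=0,1,\dots,N$, $$E^{\varphi_\pi}_\gamma\Big[\int_0^\infty\int_A c_i(\xi_t,a)\varphi_\pi(da|\xi_t)dt\Big]\le E^\pi_\gamma\Big[\int_0^\infty\int_A c_i(\xi_t,a)\pi(da|\omega,t)dt\Big].$$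
   Context: CTMDP model. $S$ and $A$ are nonempty Borel spaces, $\gamma$ is a probability measure on $\mathcal B(S)$, and $q(dy|x,a)$ is a signed kernel on $\mathcal B(S)$ given $(x,a)\in S\times A$ such that $\tilde q(\Gamma|x,a):=q(\Gamma\setminus\{x\}|x,a)\ge0$ for all $\Gamma\in\mathcal B(S)$, $q(S|x,a)=0$, and, with $q_x(a):=-q(\{x\}|x,a)\ge0$, $\sup_{a\in A}q_x(a)<\infty$ for each $x\in S$. Conventions: $0/0:=0$, $0\cdot\infty:=0$, $c/0:=+\infty$ for $c>0$. Let $x_\infty\notin S$ be an isolated point. The sample space $\Omega$ consists of sequences $\omega=(x_0,\theta_1,x_1,\theta_2,\dots)$ with $x_n\in S$, $\theta_n\in(0,\infty)$, together with sequences $(x_0,\theta_1,\dots,\theta_n,x_n,\infty,x_\infty,\infty,x_\infty,\dots)$; $t_0:=0$, $t_n:=t_{n-1}+\theta_n$, $t_\infty:=\lim_n t_n$, $\xi_t:=\sum_{n\ge0}I\{t_n\le t<t_{n+1}\}x_n+I\{t_\infty\le t\}x_\infty$. A policy $\pi=(\pi_n)_{n\ge1}$ is a sequence of stochastic kernels $\pi_n(da|x_0,\theta_1,\dots,x_{n-1},s)$ on $A$ ($s>0$ is the time since the last jump), and $\pi(da|\omega,t):=\sum_{n\ge0}I\{t_n<t\le t_{n+1}\}\pi_{n+1}(da|x_0,\theta_1,\dots,x_n,t-t_n)$ for $t<t_\infty$ (after $t_\infty$ a dummy action at which all rates and costs vanish is used). A policy is Markov if $\pi_n$ depends only on $(x_{n-1},s)$,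 deterministic Markov if moreover each $\pi_n(\cdot|x,s)$ is a Dirac measure, and stationary if $\pi_n(da|x_0,\dots,x_{n-1},s)=\varphi(da|x_{n-1})$ for one stochastic kernel $\varphi$ (identified with the policy); a measurable map $g:S\to A$ is identified with the stationary policy $\delta_{g(x)}$. $\Pi$ is the set of all policies, $\Pi_{DM}$ the set of deterministic Markov policies. Under $\pi$, $P^\pi_\gamma$ is the unique probability on $\Omega$ such that $x_0\sim\gamma$, $P^\pi_\gamma(\theta_{n+1}\ge t|x_0,\theta_1,\dots,x_n)=\exp(-\int_0^t\int_A q_{x_n}(a)\pi_{n+1}(da|x_0,\dots,x_n,s)ds)$, and $P^\pi_\gamma(x_{n+1}\in\Gamma|x_0,\dots,x_n,\theta_{n+1})=\frac{\int_A\tilde q(\Gamma|x_n,a)\pi_{n+1}(da|x_0,\dots,x_n,\theta_{n+1})}{\int_A q_{x_n}(a)\pi_{n+1}(da|x_0,\dots,x_n,\theta_{n+1})}$ for $\Gamma\in\mathcal B(S)$, the remaining probability going to $x_\infty$; $E^\pi_\gamma$ is its expectation, and $P^\pi_x,E^\pi_x$ are used when $\gamma=\delta_x$. Costs: measurable $c_0,\dots,c_N:S\times A\to[0,\infty)$, with $c_i(x_\infty,\cdot):=0$; constants $d_1,\dots,d_N\in[0,\infty)$. Constrained problem: minimize $E^\pi_\gamma[\int_0^\infty\int_A c_0(\xi_t,a)\pi(da|\omega,t)dt]$ over $\pi\in\Pi$ subject to $E^\pi_\gamma[\int_0^\infty\int_A c_j(\xi_t,a)\pi(da|\omega,t)dt]\le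 d_j$, $j=1,\dots,N$. A policy is feasible if it satisfies the constraints, and feasible with a finite value if moreover its $c_0$-objective is finite. Condition 1: (a) $A$ is compact; (b) for each bounded continuous $f$ on $S$, $(x,a)\mapsto\int_S f(y)\tilde q(dy|x,a)/q_x(a)$ is continuous; (c) $(x,a)\mapsto q_x(a)$ is continuous; (d) each $c_i$ is lower semicontinuous on $S\times A$. Occupation measure: $\eta^\pi_\gamma(\Gamma_S\times\Gamma_A):=E^\pi_\gamma[\int_0^\infty I\{\xi_t\in\Gamma_S\}\pi(\Gamma_A|\omega,t)dt]$. Sets: $S_2:=\{x\in S:\inf_{a\in A}(q_x(a)+\sum_{i=0}^N c_i(x,a))=0\}$; $\zeta:=\{x\in S:\inf_{\pi\in\Pi_{DM}}E^\pi_x[\int_0^\infty\int_A\sum_{i=0}^Nc_i(\xi_t,a)\pi(da|\omega,t)dt]>0\}$ (a measurable set under Condition 1), $\zeta^c:=S\setminus\zeta$. $f^\ast:S\to A$ is a fixed measurable map with $\sum_{i=0}^Nc_i(x,f^\ast(x))+q_x(f^\ast(x))=0$ for all $x\in S_2$, and $\psi^\ast:S\to A$ is a fixed measurable map such that $E^{\psi^\ast}_x[\int_0^\infty\sum_{i=0}^Nc_i(\xi_t,\psi^\ast(\xi_t))dt]=0$ for all $x\in\zeta^c$ and $\psi^\ast=f^\ast$ on $S_2$ (such maps exist under Condition 1). *)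

(* Defs.v *)
From HB Require Import structures.
From mathcomp Require Import all_boot all_order all_algebra.
From mathcomp Require Import all_classical all_reals all_analysis measurable_realfun.

Set Implicit Arguments.
Unset Strict Implicit.
Unset Printing Implicit Defensive.

Import Order.TTheory GRing.Theory Num.Theory.
Import numFieldNormedType.Exports.

Local Open Scope classical_set_scope.
Local Open Scope ring_scope.

Definition borel (T : ptopologicalType) := g_sigma_algebraType (@open T).

(* Borel space: (homeomorphic to) a Borel subset of a Polish space
   (complete separable metrizable space), with the relative topology. *)
Definition borel_space (R : realType) (T : ptopologicalType) : Prop :=
  exists (Y : completePseudoMetricType R) (e : T -> Y),
    [/\ hausdorff_space Y,
        (exists2 D : set Y, countable D & dense D),
        injective e,
        continuous e /\ (forall U : set T, open U -> exists2 V : set Y, open V & U = e @^-1` V)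
      & <<s @open Y >> (range e)].

Section CTMDP.
Context (R : realType) (S A : ptopologicalType).
Local Notation Sm := (borel S).
Local Notation Am := (borel A).

(* one coordinate of a trajectory: (theta_k, x_k); theta_0 is a dummy *)
Definition point := (\bar R * Sm)%type.

Definition omega_gen : set (set (nat -> point)) :=
  \bigcup_(k in [set: nat]) preimage_set_system setT (fun w : nat -> point => w k) measurable.

Definition Omega := g_sigma_algebraType omega_gen.

Definition X (n : nat) (w : Omega) : Sm := (w n).2.
Definition Th (n : nat) (w : Omega) : \bar R := (w n).1.
Definition Tj (n : nat) (w : Omega) : \bar R := (\sum_(1 <= k < n.+1) Th k w)%E.

(* p n = pi_{n+1}(da | x_0, theta_1, ..., x_n, s) *)
Definition policy := nat -> Omega -> R -> {measure set Am -> \bar R}.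

Definition is_policy (p : policy) : Prop :=
  [/\ (forall n w s, p n w s setT = 1%E),
      (forall n (w w' : Omega) s, X 0 w = X 0 w' ->
          (forall k, (0 < k <= n)%N -> w k = w' k) ->
          forall U, p n w s U = p n w' s U)
    & (forall n (U : set Am), measurable U ->
          measurable_fun setT (fun ws : Omega * R => p n ws.1 ws.2 U))].

Definition stoch_kernel (phi : Sm -> {measure set Am -> \bar R}) : Prop :=
  (forall x, phi x setT = 1%E) /\
  (forall U : set Am, measurable U -> measurable_fun setT (fun x => phi x U)).

Definition stationary (phi : Sm -> {measure set Am -> \bar R}) : policy :=
  fun n w s => phi (X n w).

Definition det_stationary (g : Sm -> Am) : policy :=
  stationary (fun x => (\d_(g x) : {measure set Am -> \bar R})).

Definition det_markov (p : policy) : Prop :=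
  is_policy p /\
  forall n, exists g : Sm -> R -> Am,
    forall w s U, p n w s U = \d_(g (X n w) s) U.

(* integrand  int_A f(xi_t, a) pi(da | w, t), with
   xi_t = x_n for t_n <= t < t_{n+1} and pi(da|w,t) = pi_{m+1}(da|h_m, t - t_m)
   for t_m < t <= t_{m+1}; it is 0 for t >= t_infty (dummy action). *)
Definition rate (p : policy) (f : Sm -> Am -> \bar R) (w : Omega) (t : R) : \bar R :=
  (\sum_(n <oo) \sum_(m <oo)
     (if (Tj n w <= t%:E < Tj n.+1 w) && (Tj m w < t%:E <= Tj m.+1 w)
      then \int[p m w (t - fine (Tj m w))%R]_a f (X n w) a else 0))%E.

Definition expcost (P : probability Omega R) (p : policy) (f : Sm -> Am -> \bar R) : \bar R :=
  (\int[P]_w \int[lebesgue_measure]_(t in `[0%R, +oo[) rate p f w t)%E.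

Definition occ (P : probability Omega R) (p : policy) (G : set (Sm * Am)) : \bar R :=
  expcost P p (fun x a => (\1_G (x, a))%:E).

Definition hist_set (n : nat) (H : set Omega) : Prop :=
  measurable H /\
  forall w w' : Omega, X 0 w = X 0 w' -> (forall k, (0 < k <= n)%N -> w k = w' k) ->
    (H w <-> H w').

Definition hist_set' (n : nat) (H : set Omega) : Prop :=
  measurable H /\
  forall w w' : Omega, X 0 w = X 0 w' -> (forall k, (0 < k <= n)%N -> w k = w' k) ->
    Th n.+1 w = Th n.+1 w' -> (H w <-> H w').

Variables (qt : Sm -> Am -> {measure set Sm -> \bar R}) (qx : S -> A -> R).

(* P is the strategic measure P^p_gam: x_0 ~ gam, and conditional laws of
   theta_{n+1} and x_{n+1}, on the event that no infinite sojourn occurred. *)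
Definition strategic (gam : {measure set Sm -> \bar R}) (p : policy)
    (P : probability Omega R) : Prop :=
  [/\ (forall G : set Sm, measurable G -> P (X 0 @^-1` G) = gam G),
      (forall n H t, hist_set n H -> (0 <= t)%R ->
        P (H `&` [set w | (Tj n w < +oo)%E] `&` [set w | (t%:E <= Th n.+1 w)%E]) =
        (\int[P]_(w in H `&` [set w | (Tj n w < +oo)%E])
           expeR (- \int[lebesgue_measure]_(s in `[0%R, t])
                      \int[p n w s]_a (qx (X n w) a)%:E))%E)
    & (forall n H (G : set Sm), hist_set' n H -> measurable G ->
        P (H `&` [set w | (Tj n.+1 w < +oo)%E] `&` (X n.+1 @^-1` G)) =
        (\int[P]_(w in H `&` [set w | (Tj n.+1 w < +oo)%E])
           (fine (\int[p n w (fine (Th n.+1 w))]_a qt (X n w) a G) /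
            fine (\int[p n w (fine (Th n.+1 w))]_a (qx (X n w) a)%:E))%:E)%E)].

End CTMDP.

Section Derived.
Context (R : realType) (S A : ptopologicalType).
Local Notation Sm := (borel S).
Local Notation Am := (borel A).

Definition qrate (q : Sm -> Am -> {charge set Sm -> \bar R}) (x : S) (a : A) : R :=
  - fine (q x a [set x]).

Definition cE (f : S -> A -> R) : Sm -> Am -> \bar R := fun x a => (f x a)%:E.

Definition csum (c : nat -> S -> A -> R) (N : nat) : Sm -> Am -> \bar R :=
  fun x a => (\sum_(i < N.+1) c i x a)%:E.

Definition S2 (q : Sm -> Am -> {charge set Sm -> \bar R}) (c : nat -> S -> A -> R)
    (N : nat) : set Sm :=
  [set x | ereal_inf [set (qrate q x a + \sum_(i < N.+1) c i x a)%:E | a in [set: A]] = 0%E].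

(* zeta = { x : inf_{pi in Pi_DM} E^pi_x [ int_0^oo int_A sum_i c_i dt ] > 0 },
   where Pfam p g is the strategic measure P^p_g *)
Definition zeta (Pfam : policy R S A -> {measure set Sm -> \bar R} -> probability (Omega R S) R)
    (c : nat -> S -> A -> R) (N : nat) : set Sm :=
  [set x | (0 < ereal_inf [set expcost (Pfam p (\d_x : {measure set Sm -> \bar R})) p (csum c N)
                           | p in [set p | det_markov p]])%E].

End Derived.

(* Main.v *)
Require Import Defs.
From HB Require Import structures.
From mathcomp Require Import all_boot all_order all_algebra.
From mathcomp Require Import all_classical all_reals all_analysis measurable_realfun.
From mathcomp Require Import ring lra.
Import Order.TTheory GRing.Theory Num.Theory.
Import numFieldNormedType.Exports.
Local Open Scope classical_set_scope.
Local Open Scope ring_scope.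
Set Implicit Arguments.
Unset Strict Implicit.
Unset Printing Implicit Defensive.

(** Write [eta] for the occupation measure of [pi], [m] for the expected number of
    visits under [pi], and [m_phi], [q_phi] for the expected visits and the exit
    rate under the stationary policy [phi].  Integrating the law of a sojourn gives
    [m(G) = gam(G) + int qt(G|x,a) eta(dx,da)].  On [zeta] the infimum over [a] of
    exit rate plus cost is positive (it vanishes only on [S2], which lies in the
    complement of [zeta]), so a finite total cost forces every sojourn in [zeta] to
    end, and [int_G q_x(a) eta(dx,da) = m(G)] for [G] in [zeta].  Disintegrating
    [eta] by [phi], an induction on the number of jumps gives [m_phi <= m] on [zeta],
    because [zeta] cannot be entered from its complement, where [phi] is [psistar].
    The cost under [phi] is the integral of [c_phi / q_phi] against [m_phi]; it
    vanishes off [zeta], and on [zeta] it is at most the integral against [m], that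
    is, the cost of [pi].  The set [zeta] itself is measurable since its complement
    is the zero set of the total cost of [psistar]. *)

(** * Mixtures of measures *)

(** [strategic] prescribes probabilities of events and [hocc] compares values on sets, whereas the
    argument integrates functions. Each such passage builds measures out of weighted kernels and
    compares them on sets, which requires no sigma-finiteness of the occupation measure. The
    comparison rests on a one-sided estimate. On zeta, the visits under pi have density q_phi with
    respect to the state marginal of eta. If h_phi is the mean sojourn time under phi, then h_phi
    q_phi <= 1, so h_phi m is at most that marginal. Nothing is divided by q_phi: where q_phi = 0
    the time h_phi is infinite, and the product is 0 by convention. A second obstacle is the sample
    space: trajectories are arbitrary sequences in the extended reals. Positivity of the sojourns is
    a property of their law, to be proved almost surely before the time integral of a path can be
    cut at its jumps. *)

Section mixture.
Local Open Scope ereal_scope.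
Context d1 d2 (Y : measurableType d1) (Z : measurableType d2) (R : realType).
Variables (mu : {measure set Y -> \bar R}) (k : Y -> {measure set Z -> \bar R}).
Hypothesis mk : forall U, measurable U -> measurable_fun setT (fun y => k y U).

Import HBNNSimple.

Let mix (U : set Z) : \bar R := \int[mu]_y k y U.

Let mix0 : mix set0 = 0.
Proof. by rewrite /mix integral0_eq// => y _; rewrite measure0. Qed.

Let mix_ge0 U : 0 <= mix U.
Proof. by apply: integral_ge0 => y _; exact: measure_ge0. Qed.

Let mix_sigma : semi_sigma_additive mix.
Proof.
move=> F mF tF mUF; rewrite /mix.
rewrite [X in _ --> X](_ : _ = \sum_(n <oo) \int[mu]_y k y (F n)).
  by apply: is_cvg_nneseries => n _ _; exact: mix_ge0.
rewrite -integral_nneseries//; last by move=> n; exact: mk.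
apply: eq_integral => y _; apply/esym/cvg_lim => //.
exact: measure_semi_sigma_additive.
Qed.

(** Both sides of the integral formula are limits over the same increasing simple functions, by
    monotone convergence. Neither [mu] nor the kernel has to be finite, so the lemma applies to the
    occupation measure. *)
Lemma mixture : exists m : {measure set Z -> \bar R},
  (forall U, measurable U -> m U = \int[mu]_y k y U) /\
  (forall f, measurable_fun setT f -> (forall z, 0 <= f z) ->
     \int[m]_z f z = \int[mu]_y \int[k y]_z f z).
Proof.
pose mx := isMeasure.Build _ _ _ mix mix0 mix_ge0 mix_sigma.
pose m : {measure set Z -> \bar R} := HB.pack mix mx.
exists m; split=> // f mf f0.
pose f_ := nnsfun_approx measurableT mf.
have ndf z : {homo (fun n => (f_ n z)%:E) : a b / (a <= b)%N >-> a <= b}.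
  by move=> a b ab; rewrite lee_fin; exact/lefP/nd_nnsfun_approx.
have intE (nu : {measure set Z -> \bar R}) :
    \int[nu]_z f z = limn (fun n => \int[nu]_z (f_ n z)%:E).
  rewrite -monotone_convergence//.
  - by apply: eq_integral => z _; apply/esym/cvg_lim => //; exact: cvg_nnsfun_approx.
  - by move=> n; exact/measurable_EFinP/measurable_funP.
  - by move=> n z _; rewrite lee_fin.
rewrite (intE m).
have mint n : measurable_fun setT (fun y => \int[k y]_z (f_ n z)%:E).
  apply: (measurable_fun_integral_kernel mk) => [z|]; first by rewrite lee_fin.
  exact/measurable_EFinP/measurable_funP.
transitivity (limn (fun n => \int[mu]_y \int[k y]_z (f_ n z)%:E)); last first.
  rewrite -monotone_convergence//.
  - by apply: eq_integral => y _; rewrite intE.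
  - by move=> n y _; apply: integral_ge0 => z _ /=; rewrite lee_fin.
  - move=> y _ a b ab; apply: ge0_le_integral => //.
    + by move=> z _; rewrite lee_fin.
    + exact/measurable_EFinP/measurable_funP.
    + exact/measurable_EFinP/measurable_funP.
    + by move=> z _; exact: ndf.
congr (limn _); apply/funext => n.
rewrite integralT_nnsfun sintegralE.
under [RHS]eq_integral do rewrite integralT_nnsfun sintegralE.
rewrite ge0_integral_fsum//.
- apply: eq_fsbigr => r _; rewrite {1}/m/= /mix.
  have [r0|r0] := leP 0%R r.
    by rewrite ge0_integralZl//; apply: mk.
  rewrite preimage_nnfun0// integral0_eq ?mule0 => [|y _]; last by rewrite measure0.
  by rewrite integral0_eq// => y _; rewrite measure0 mule0.
- by move=> r; apply: measurable_funeM; exact: mk.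
- by move=> r y _; exact: nnsfun_mulemu_ge0.
Qed.

End mixture.

Lemma weighted_mixture d1 d2 (Y : measurableType d1) (Z : measurableType d2)
    (R : realType) (mu : {measure set Y -> \bar R})
    (k : Y -> {measure set Z -> \bar R}) (g : Y -> R) :
  (forall U, measurable U -> measurable_fun setT (fun y => k y U)) ->
  measurable_fun setT g -> (forall y, 0 <= g y) ->
  exists m : {measure set Z -> \bar R},
  (forall U, measurable U -> m U = \int[mu]_y ((g y)%:E * k y U))%E /\
  (forall f, measurable_fun setT f -> (forall z, 0 <= f z)%E ->
     \int[m]_z f z = \int[mu]_y ((g y)%:E * \int[k y]_z f z))%E.
Proof.
move=> mk mg g0.
pose k' y : {measure set Z -> \bar R} := mscale (NngNum (g0 y)) (k y).
have [|m [mE mI]] := @mixture _ _ _ _ _ mu k'.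
  move=> U mU; rewrite /k' /mscale/=; apply: emeasurable_funM => //.
    exact/measurable_EFinP.
  exact: mk.
exists m; split=> [U mU|f mf f0]; first by rewrite mE.
by rewrite mI//; apply: eq_integral => y _; rewrite /k' ge0_integral_mscale.
Qed.

(** Transfers an identity known for sets to nonnegative functions: the two sides are integrals
    against two mixtures that agree as measures. The weights are real-valued, so an infinite weight
    has to be replaced beforehand. *)
Lemma mixture_eq d1 d2 d3 (Y1 : measurableType d1) (Y2 : measurableType d2)
    (Z : measurableType d3) (R : realType)
    (mu1 : {measure set Y1 -> \bar R}) (mu2 : {measure set Y2 -> \bar R})
    (k1 : Y1 -> {measure set Z -> \bar R}) (k2 : Y2 -> {measure set Z -> \bar R})
    (g1 : Y1 -> R) (g2 : Y2 -> R) (f : Z -> \bar R) :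
  (forall U, measurable U -> measurable_fun setT (fun y => k1 y U)) ->
  (forall U, measurable U -> measurable_fun setT (fun y => k2 y U)) ->
  measurable_fun setT g1 -> measurable_fun setT g2 ->
  (forall y, 0 <= g1 y) -> (forall y, 0 <= g2 y) ->
  (forall U, measurable U -> \int[mu1]_y ((g1 y)%:E * k1 y U) =
                             \int[mu2]_y ((g2 y)%:E * k2 y U))%E ->
  measurable_fun setT f -> (forall z, 0 <= f z)%E ->
  (\int[mu1]_y ((g1 y)%:E * \int[k1 y]_z f z) =
   \int[mu2]_y ((g2 y)%:E * \int[k2 y]_z f z))%E.
Proof.
move=> mk1 mk2 mg1 mg2 g10 g20 E mf f0.
have [m1 [m1E m1I]] := weighted_mixture mu1 mk1 mg1 g10.
have [m2 [m2E m2I]] := weighted_mixture mu2 mk2 mg2 g20.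
rewrite -m1I// -m2I//; apply: eq_measure_integral => U mU _.
by rewrite m1E// m2E// E.
Qed.

(** * Exponential of an integrated rate *)

Lemma ge0_integral_translation (R : realType) (f : R -> \bar R) (c : R) :
  measurable_fun setT f -> (forall t, 0 <= f t)%E ->
  (\int[lebesgue_measure]_t f (t - c)%R = \int[lebesgue_measure]_t f t)%E.
Proof.
move=> mf f0; pose h (t : measurableTypeR R) : measurableTypeR R := t - c.
have mh : measurable_fun setT h by exact: (@measurable_funB _ _ R).
have E : forall U : set (measurableTypeR R), measurable U ->
    lebesgue_measure U = pushforward lebesgue_measure h U.
  apply: (@lebesgue_measure_unique R
    (measure_function_pushforward__canonical__measure_function_Measure lebesgue_measure mh)) => _ [[a b] _ <-].
  rewrite /= /pushforward (_ : h @^-1` _ = `]a + c, b + c]%classic).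
    rewrite !lebesgue_measure_itv/= !lte_fin ltrD2r -!EFinD.
    by rewrite opprD addrACA subrr addr0.
  by apply/seteqP; split=> t /=; rewrite !in_itv/= /h ltrBrDr lerBlDr.
transitivity (\int[pushforward lebesgue_measure h]_t f t)%E.
  by rewrite ge0_integral_pushforward.
by apply: eq_measure_integral => U mU _; exact/esym/E.
Qed.

(** The moving upper limit becomes the indicator of the region 0 <= s <= t, a fixed measurable set
    of the product, to which Tonelli applies. *)
Lemma measurable_fun_cumulative d (T : measurableType d) (R : realType)
    (f : T * R -> \bar R) :
  measurable_fun setT f -> (forall z, 0 <= f z)%E ->
  measurable_fun setT (fun wt : T * R =>
    \int[lebesgue_measure]_(s in `[0%R, wt.2]) f (wt.1, s))%E.
Proof.
move=> mf f0.
pose A : set ((T * R) * R) := [set z | 0 <= z.2] `&` [set z | z.2 <= z.1.2].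
have mA : measurable A.
  apply: measurableI; rewrite -[X in measurable X]setTI; apply: measurable_fun_le => //.
  exact: measurableT_comp.
pose F (z : (T * R) * R) := (f (z.1.1, z.2) * (\1_A z)%:E)%E.
have mF : measurable_fun setT F.
  apply: emeasurable_funM.
    apply: measurableT_comp => //; apply: measurable_fun_pair => //.
    exact: measurableT_comp.
  exact/measurable_EFinP/measurable_indic.
have F0 z : (0 <= F z)%E by rewrite mule_ge0// lee_fin.
rewrite (_ : (fun _ => _) = fubini_F lebesgue_measure F).
  exact: measurable_fun_fubini_tonelli_F.
apply/funext => -[w t]; rewrite /fubini_F [LHS]integral_mkcond/=.
apply: eq_integral => s _; rewrite patchE /F indicE.
have -> : ((w, t, s) \in A) = (s \in [set` `[0%R, t]]).
  by apply/idP/idP; rewrite !inE /A/= in_itv/= => /andP.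
by case: ifP => _; rewrite ?mule1 ?mule0.
Qed.

(** By convexity [expR (- a) - expR (- b)] satisfies the same two bounds as [I], and these bounds
    are at distance [(expR (- a) - expR (- b)) * (b - a)], at most the square of [b - a]. *)
Lemma expR_increment_bound (R : realType) (a b I : R) : 0 <= a -> a <= b ->
  expR (- b) * (b - a) <= I -> I <= expR (- a) * (b - a) ->
  `|I - (expR (- a) - expR (- b))| <= (b - a) ^+ 2.
Proof.
move=> a0 ab lo hi.
have et : expR (- b) = expR (- a) * expR (- (b - a)).
  by rewrite -expRD; congr expR; ring.
have es : expR (- a) = expR (- b) * expR (b - a).
  by rewrite -expRD; congr expR; ring.
have e1 := expR_ge1Dx (b - a); have e2 := expR_ge1Dx (- (b - a)).
have ps := expR_gt0 (- a); have pt := expR_gt0 (- b).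
have s1 : expR (- a) <= 1 by rewrite expR_le1 oppr_le0.
have x0 : 0 <= b - a by rewrite subr_ge0.
set x := b - a in lo hi et es e1 e2 x0 *.
set u := expR (- a) in lo hi et es ps s1 *.
set v := expR (- b) in lo hi et es pt *.
clearbody x u v.
have b1 : v * (1 + x) <= u by rewrite es ler_wpM2l// ltW.
have b2 : u * (1 - x) <= v by rewrite et ler_wpM2l// ltW.
have b3 : (u - v) * x <= x ^+ 2.
  rewrite expr2 ler_wpM2r//.
  have : u * x <= x by rewrite -[leRHS]mul1r ler_wpM2r.
  by move: b2; rewrite mulrBr mulr1; lra.
move: b1 b2 b3; rewrite mulrDr mulrBr mulrBl !mulr1 => b1 b2 b3.
by rewrite ler_norml; apply/andP; split; lra.
Qed.

Section hazard.
Context (R : realType) (l : R -> R) (M : R).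
Hypothesis ml : measurable_fun setT l.
Hypothesis l0 : forall s, 0 <= l s.
Hypothesis lM : forall s, l s <= M.
Local Notation leb := (@lebesgue_measure R).
Let L (t : R) : R := \int[leb]_(s in `[0, t]) l s.
Let h (s : R) : R := l s * expR (- L s).

Let M0 : 0 <= M. Proof. exact: le_trans (l0 0) (lM 0). Qed.

Let integrable_bd (g : R -> R) (i : interval R) a b :
  i = Interval (BSide true a) (BSide false b) \/
  i = Interval (BSide false a) (BSide false b) ->
  measurable_fun setT g -> (forall s, 0 <= g s <= M) ->
  leb.-integrable [set` i] (EFin \o g).
Proof.
move=> iE mg gM; apply: measurable_bounded_integrable => //.
- by case: iE => ->; rewrite /= lebesgue_measure_itv/=; case: ifP => _;
    rewrite ?ltry// -EFinD ltry.
- exact: measurable_funTS.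
- exists M; split; first by rewrite num_real.
  move=> x Mx s _ /=; have /andP[g0 gM'] := gM s.
  by rewrite ger0_norm// (le_trans gM')// ltW.
Qed.

Let lint s : 0 <= l s <= M. Proof. by rewrite l0 lM. Qed.

Lemma hazardE t : (\int[leb]_(s in `[0%R, t]) (l s)%:E)%E = (L t)%:E.
Proof.
rewrite /L /Rintegral fineK//; apply: integrable_fin_num => //.
by apply: (@integrable_bd l _ 0 t) => //; left.
Qed.

Lemma hazard_incr s t : 0 <= s -> s <= t ->
  L t - L s = \int[leb]_(u in `]s, t]) l u.
Proof.
move=> s0 st; rewrite /L Rintegral_itvB//.
by apply: (@integrable_bd l _ 0 t) => //; left.
Qed.

Let leb_oc s t : s <= t -> fine (leb `]s, t]) = t - s.
Proof.
move=> st; rewrite lebesgue_measure_itv/= lte_fin; case: ltP => // ts.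
have -> : s = t by apply/le_anti; rewrite st ts.
by rewrite subrr.
Qed.

Lemma hazard_le s t : 0 <= s -> s <= t -> 0 <= L t - L s <= M * (t - s).
Proof.
move=> s0 st; rewrite hazard_incr// Rintegral_ge0//=.
rewrite -leb_oc// -Rintegral_cst//; apply: le_Rintegral => //.
  by apply: (@integrable_bd l _ s t) => //; right.
by apply: (@integrable_bd (cst M) _ s t) => //=; [right|rewrite M0 lexx].
Qed.

Lemma measurable_hazard : measurable_fun setT L.
Proof.
rewrite /L /Rintegral; apply: measurableT_comp => //.
pose f (z : R * R) := (l z.2)%:E.
have mf : measurable_fun setT f.
  by apply/measurable_EFinP; exact: measurableT_comp.
have f0 z : (0 <= f z)%E by rewrite lee_fin.
have H := @measurable_fun_cumulative _ R R f mf f0.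
exact: (measurableT_comp H (@pair1_measurable _ _ R R 0)).
Qed.

Lemma hazard_ge0 t : 0 <= L t.
Proof. by rewrite /L Rintegral_ge0. Qed.

Let mh : measurable_fun setT h.
Proof.
apply: measurable_funM => //; apply: measurableT_comp => //.
by apply: measurableT_comp => //; exact: measurable_hazard.
Qed.

Let hint s : 0 <= h s <= M.
Proof.
rewrite /h mulr_ge0 ?expR_ge0//=.
rewrite -[leRHS]mulr1 ler_pM ?expR_ge0//.
by rewrite expR_le1 oppr_le0 hazard_ge0.
Qed.

Let D t := \int[leb]_(s in `[0, t]) h s + expR (- L t).

(** On []s, t]] the factor [expR (- L u)] lies between its values at the two ends, which squeezes
    the integral of [h] as [expR_increment_bound] requires. A quadratic modulus forces [D] to be
    constant. *)
Let D_lipschitz s t : 0 <= s -> s <= t -> `|D t - D s| <= (M * (t - s)) ^+ 2.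
Proof.
move=> s0 st; have /andP[L1 L2] := hazard_le s0 st.
have mono u v : 0 <= u -> u <= v -> L u <= L v.
  by move=> u0 uv; have /andP[] := hazard_le u0 uv; rewrite subr_ge0.
have E : D t - D s = \int[leb]_(u in `]s, t]) h u - (expR (- L s) - expR (- L t)).
  rewrite -(@Rintegral_itvB _ h (BLeft 0) _ s)//; last first.
    by apply: (@integrable_bd h _ 0 t) => //; left.
  by rewrite /D opprD addrACA opprB.
have lo : expR (- L t) * (L t - L s) <= \int[leb]_(u in `]s, t]) h u.
  rewrite hazard_incr// -RintegralZl//; last first.
    by apply: (@integrable_bd l _ s t) => //; right.
  apply: le_Rintegral => //.
  - rewrite (_ : EFin \o _ = (fun x => (expR (- L t))%:E * (EFin \o l) x)%E)//.
    by apply: integrableZl => //; apply: (@integrable_bd l _ s t) => //; right.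
  - by apply: (@integrable_bd h _ s t) => //; right.
  - move=> u /=; rewrite in_itv/= => /andP[su ut]; rewrite /h mulrC.
    by rewrite ler_wpM2l// ler_expR lerN2 mono// (le_trans s0)// ltW.
have hi : \int[leb]_(u in `]s, t]) h u <= expR (- L s) * (L t - L s).
  rewrite hazard_incr// -RintegralZl//; last first.
    by apply: (@integrable_bd l _ s t) => //; right.
  apply: le_Rintegral => //.
  - by apply: (@integrable_bd h _ s t) => //; right.
  - rewrite (_ : EFin \o _ = (fun x => (expR (- L s))%:E * (EFin \o l) x)%E)//.
    by apply: integrableZl => //; apply: (@integrable_bd l _ s t) => //; right.
  - move=> u /=; rewrite in_itv/= => /andP[su ut]; rewrite /h mulrC.
    by rewrite ler_wpM2r// ler_expR lerN2 mono// ltW.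
rewrite E; apply: le_trans (expR_increment_bound _ _ lo hi) _.
- exact: hazard_ge0.
- exact: mono.
- by rewrite ler_sqr ?nnegrE// (le_trans L1).
Qed.

(** The rate [l] is only measurable and bounded, so [L] need not be differentiable everywhere.
    Instead [[0, t]] is cut into n + 1 equal pieces; the quadratic errors add up to at most
    [(M * t) ^+ 2 / n.+1], which tends to 0. *)
Lemma hazard_ftc t : 0 <= t -> \int[leb]_(s in `[0, t]) h s = 1 - expR (- L t).
Proof.
move=> t0; suff : D t = 1 by rewrite /D => <-; ring.
have D0 : D 0 = 1.
  by rewrite /D /L set_itv1 !Rintegral_set1 oppr0 expR0 add0r.
have bd n : `|D t - 1| <= (M * t) ^+ 2 / n.+1%:R.
  pose e := t / n.+1%:R.
  have e0 : 0 <= e by rewrite divr_ge0.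
  have H k : `|D (k%:R * e) - 1| <= k%:R * (M * e) ^+ 2.
    elim: k => [|k ih]; first by rewrite !mul0r D0 subrr normr0.
    have := @D_lipschitz (k%:R * e) (k.+1%:R * e).
    rewrite mulr_ge0// ler_wpM2r// ?ler_nat// => /(_ isT isT).
    rewrite -mulrBl -natrB// subSnn mul1r => H.
    rewrite -[X in `|X|](subrKA (D (k%:R * e))) -[in leRHS]natr1 mulrDl mul1r [leRHS]addrC.
    by apply: le_trans (ler_normD _ _) _; rewrite lerD.
  have := H n.+1; rewrite /e mulrCA divff// mulr1 => /le_trans; apply.
  rewrite le_eqVlt; apply/orP; left; apply/eqP; field.
  by rewrite addrC natr1 pnatr_eq0.
apply/eqP; rewrite -subr_eq0 -normr_le0; apply/ler_addgt0Pl => e e0.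
rewrite addr0.
have K0 : 0 <= (M * t) ^+ 2 by rewrite sqr_ge0.
have := bd (Num.truncn ((M * t) ^+ 2 / e)) => /le_trans; apply.
rewrite ler_pdivrMr// [leRHS]mulrC -ler_pdivrMr//.
by apply/ltW; rewrite truncnS_gt.
Qed.

Lemma hazard_ftcE t : 0 <= t ->
  (\int[leb]_(s in `[0%R, t]) (h s)%:E)%E = (1 - expR (- L t))%:E.
Proof.
move=> t0; rewrite -hazard_ftc// /Rintegral fineK//; apply: integrable_fin_num => //.
by apply: (@integrable_bd h _ 0 t) => //; left.
Qed.

Lemma hazard_le1 : (\int[leb]_(s in `[0%R, +oo[) (h s)%:E <= 1)%E.
Proof.
rewrite ge0_integral_ereal_sup//; last by move=> s; have /andP[] := hint s.
apply: ge_ereal_sup => _ [i _ <-]; rewrite hazard_ftcE// lee_fin.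
by rewrite gerBl expR_ge0.
Qed.

Lemma hazard_eq1 : (forall B, exists2 t, 0 <= t & B <= L t) ->
  (\int[leb]_(s in `[0%R, +oo[) (h s)%:E = 1)%E.
Proof.
move=> Loo; apply/eqP; rewrite eq_le hazard_le1/=.
apply/lee_addgt0Pr => e e0.
(* The missing mass after time t is [expR (- L t)], and [expR (L t) >= 1 + L t]; so [L t >= e^-1]
   leaves at most [e]. *)
have [t t0 tB] := Loo (e^-1).
have H : (\int[leb]_(s in `[0%R, t]) (h s)%:E <= \int[leb]_(s in `[0%R, +oo[) (h s)%:E)%E.
  apply: ge0_subset_integral => //.
  - by apply/measurable_EFinP; exact: measurable_funTS.
  - by move=> s _; rewrite lee_fin; have /andP[] := hint s.
  - by apply: subset_itvl.
rewrite hazard_ftcE// in H.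
apply: le_trans (leeD H (lexx _)).
rewrite -EFinD lee_fin -addrA lerDl addrC subr_ge0.
have := expR_ge1Dx (L t) => H2.
rewrite expRN -[leRHS]invrK lef_pV2 ?posrE ?invr_gt0// ?expR_gt0//.
by lra.
Qed.

End hazard.

(** * Kernels and Borel spaces *)

Section probability_kernel.
Local Open Scope ereal_scope.
Context d d' (X : measurableType d) (Y : measurableType d') (R : realType).
Variable k : X -> {measure set Y -> \bar R}.
Hypothesis k1 : forall x, k x setT = 1.
Hypothesis mk : forall U, measurable U -> measurable_fun setT (fun x => k x U).

Let pack : exists k' : R.-pker X ~> Y, forall x U, k' x U = k x U.
Proof.
pose H1 := isKernel.Build _ _ _ _ _ k mk.
pose k0 : R.-ker X ~> Y := HB.pack k H1.
pose H2 := Kernel_isProbability.Build _ _ _ _ _ k0 k1.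
pose k2 : R.-pker X ~> Y := HB.pack k H1 H2.
by exists k2.
Qed.

Lemma measurable_fun_xsection_prob A : measurable A ->
  measurable_fun setT (fun x => k x (xsection A x)).
Proof.
have [k' kE] := pack => mA.
under eq_fun do rewrite -kE.
by apply: measurable_fun_xsection_finite_kernel; rewrite inE.
Qed.

Lemma measurable_fun_integral_prob (f : X * Y -> \bar R) :
  measurable_fun setT f -> (forall z, 0 <= f z) ->
  measurable_fun setT (fun x => \int[k x]_y f (x, y)).
Proof.
have [k' kE] := pack => mf f0.
rewrite (_ : (fun _ => _) = (fun x => \int[k' x]_y f (x, y))).
  exact: measurable_fun_integral_finite_kernel.
by apply/funext => x; apply: eq_measure_integral => U mU _; rewrite kE.
Qed.

End probability_kernel.

Section borel_space_facts.
Context (R : realType).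

(** A countable base pulled back from the Polish space along the embedding: [i] encodes a point of
    the dense set and [j] a radius. *)
Lemma borel_space_base (T : ptopologicalType) : borel_space R T ->
  exists B : nat -> nat -> set T, (forall i j, open (B i j)) /\
    forall U x, open U -> U x -> exists i j, B i j x /\ B i j `<=` U.
Proof.
move=> [Y [e [_ [D cD dD] _ [ce oe] _]]].
have [f finj] := elimT (countable_injP D) cD.
pose r (j : nat) : R := j.+1%:R^-1.
(* As [f] is injective on [D], the union has at most one term; it stands for the ball around the
   inverse image of [i] without an inverse being chosen. The doubled radius makes a point within
   [r j] of the centre interior to the ball. *)
exists (fun i j => e @^-1` (\bigcup_(d in D `&` f @^-1` [set i]) (ball d (r j + r j))°)).
split=> [i j|U x oU Ux].
  move/continuousP : ce; apply; apply: bigcup_open => d _; exact: open_interior.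
have [V oV UE] := oe _ oU.
have : nbhs (e x) V by apply: open_nbhs_nbhs; split=> //; rewrite UE in Ux.
rewrite -nbhs_ballE => -[eps /= eps0 epsV].
(* Gives 4 [r j] <= [eps]: from [e x] to the centre is less than [r j], from the centre to a point
   of the ball less than 2 [r j]. *)
pose j := Num.truncn (4 / eps).
have r0 : 0 < r j by rewrite invr_gt0.
have rj : r j + r j + (r j + r j) <= eps.
  have : 4 / eps < j.+1%:R by rewrite truncnS_gt.
  rewrite ltr_pdivrMr// -ltr_pdivrMl// => /ltW; rewrite mulrC -/(r j) => H.
  by apply: le_trans H; move: (r j) => z; lra.
have [d [Bd Dd]] : ((ball (e x) (r j))° `&` D) !=set0.
  apply: dD; last exact: open_interior.
  exists (e x); apply: nbhs_singleton; apply: nbhs_interior.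
  exact: nbhsx_ballx.
exists (f d), j; split.
  exists d => //=.
  have : nbhs (e x) (ball (e x) (r j)) by exact: nbhsx_ballx.
  apply: filterS => y xy; apply: ball_triangle xy; apply: ball_sym.
  exact: interior_subset Bd.
move=> y [d' [Dd' /= fd] /interior_subset yd]; rewrite UE; apply: epsV.
have dd : d' = d by apply: finj => //; rewrite inE.
rewrite dd in yd; apply: le_ball rj _ _; rewrite -addrA; apply: ball_triangle.
  exact: interior_subset Bd.
by apply: le_ball yd; lra.
Qed.

Lemma borel_space_set1 (T : ptopologicalType) (x : borel T) :
  borel_space R T -> measurable [set x].
Proof.
move=> [Y [e [hY _ einj [ce _] _]]].
have cl : closed [set e x] by exact/accessible_closed_set1/hausdorff_accessible.
have -> : [set x] = e @^-1` [set e x].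
  by apply/seteqP; split=> y /= => [->//|/einj].
rewrite -[X in measurable X]setCK; apply: measurableC; apply: sub_sigma_algebra.
by rewrite preimage_setC; move/continuousP : ce; apply; exact: closed_openC.
Qed.

(** Measurability here refers to the product of the Borel sigma-algebras. Countable bases make every
    open set of the product a countable union of open rectangles, hence measurable. This turns
    continuity of the exit rate into joint measurability. *)
Lemma continuous_borel_measurable2 (S A : ptopologicalType) (f : S * A -> R) :
  borel_space R S -> borel_space R A -> continuous f ->
  measurable_fun setT (f : borel S * borel A -> R).
Proof.
move=> /borel_space_base[B [oB bB]] /borel_space_base[C [oC bC]] cf.
apply: (measurability _ (RGenOpens.measurableE R)).
move=> _ [_ [a [b ->] <-]]; rewrite setTI.
have oO : open (f @^-1` `]a, b[%classic).
  by move/continuousP : cf; apply; exact: interval_open.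
set O := f @^-1` _ in oO *.
have -> : O = \bigcup_i \bigcup_j \bigcup_k
    \bigcup_(l in [set l | B i j `*` C k l `<=` O]) (B i j `*` C k l).
  apply/seteqP; split=> [[x y] Oxy|z [i _] [j _] [k _] [l /= H Hz]]; last exact: H.
  have : nbhs (x, y) O by exact: open_nbhs_nbhs.
  move=> [[U V] /= [xU yV] UV].
  have [i [j [Bx BU]]] := bB _ x (open_interior U) (nbhs_singleton (nbhs_interior xU)).
  have [k [l [Cy CV]]] := bC _ y (open_interior V) (nbhs_singleton (nbhs_interior yV)).
  exists i => //; exists j => //; exists k => //; exists l => //=.
  move=> [x' y'] [/= Bx' Cy']; apply: UV; split=> /=.
    by apply: interior_subset; exact: BU.
  by apply: interior_subset; exact: CV.
do 3 apply: bigcupT_measurable => ?; apply: bigcup_measurable => l _.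
by apply: measurableX; exact: sub_sigma_algebra.
Qed.

End borel_space_facts.

(** * From the signed kernel [q] to the jump kernel [qt] *)

Section transition_rates.
Context (R : realType) (S A : ptopologicalType).
Local Notation Sm := (borel S).
Local Notation Am := (borel A).
Variables (q : Sm -> Am -> {charge set Sm -> \bar R})
  (qt : Sm -> Am -> {measure set Sm -> \bar R}).
Hypothesis hS : borel_space R S.
Hypothesis hqt : forall x a (G : set Sm), measurable G -> qt x a G = q x a (G `\ x).
Hypothesis hqS : forall x a, q x a setT = 0%E.

Lemma qt_setT x a : qt x a setT = (qrate q x a)%:E.
Proof.
have mx := borel_space_set1 x hS.
rewrite hqt// chargeD// setTI hqS sub0e /qrate EFinN fineK//.
exact: fin_num_measure.
Qed.

Lemma qrate_ge0 x a : 0 <= qrate q x a.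
Proof. by rewrite -lee_fin -qt_setT. Qed.

(** The set [G] without the point x moves with x, so measurability of [q] at fixed sets does not
    apply at once. Restoring the atom gives q(G \ {x}|x,a) = q(G|x,a) + q_x(a) 1_G(x), a sum of
    measurable functions. *)
Lemma measurable_qt :
  (forall G : set Sm, measurable G ->
     measurable_fun setT (fun xa : Sm * Am => q xa.1 xa.2 G)) ->
  measurable_fun setT (fun xa : Sm * Am => qrate q xa.1 xa.2) ->
  forall G : set Sm, measurable G ->
    measurable_fun setT (fun xa : Sm * Am => qt xa.1 xa.2 G).
Proof.
move=> mq mr G mG.
rewrite (_ : (fun _ => _) = (fun xa : Sm * Am => q xa.1 xa.2 G +
    (qrate q xa.1 xa.2 * \1_G xa.1)%:E)%E); last first.
  apply/funext => -[x a] /=; have mx := borel_space_set1 x hS.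
  rewrite hqt// chargeD// indicE; have [xG|xG] := boolP (x \in G).
    rewrite mulr1 /qrate (_ : G `&` [set x] = [set x]).
      by rewrite EFinN fineK//; exact: fin_num_measure.
    by apply/setIidr => _ ->; rewrite inE in xG.
  rewrite mulr0 (_ : G `&` [set x] = set0) ?charge0 ?sube0 ?adde0//.
  by apply/seteqP; split=> // y [/= Gy yx]; move: xG; rewrite notin_setE -yx.
apply: emeasurable_funD; first exact: mq.
apply/measurable_EFinP; apply: measurable_funM => //.
by apply: measurableT_comp => //; exact: measurable_indic.
Qed.

End transition_rates.

(** * Trajectories *)

Section trajectories.
Context (R : realType) (S : ptopologicalType).
Local Notation Om := (Omega R S).

Lemma measurable_coord k : measurable_fun setT (fun w : Om => (w k : \bar R * borel S)).
Proof.
move=> _ B mB; apply: sub_sigma_algebra; exists k => //.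
by exists B.
Qed.

Lemma measurable_to_Omega d (T : measurableType d) (f : T -> Om) :
  (forall k, measurable_fun setT (fun x => (f x k : \bar R * borel S))) ->
  measurable_fun setT f.
Proof.
move=> mf; apply: (@measurability _ _ _ _ setT f (@omega_gen R S)) => //.
move=> _ [_ [k _ [B mB <-]] <-].
rewrite (_ : f @^-1` _ = (fun x => f x k) @^-1` B).
  exact: (mf k measurableT _ mB).
by apply/seteqP; split=> x //= [].
Qed.

Lemma measurable_X n : measurable_fun setT (@X R S n).
Proof. exact: (measurableT_comp measurable_snd (measurable_coord n)). Qed.

Lemma measurable_Th n : measurable_fun setT (@Th R S n).
Proof. exact: (measurableT_comp measurable_fst (measurable_coord n)). Qed.

Lemma measurable_Tj n : measurable_fun setT (@Tj R S n).
Proof. by apply: emeasurable_sum => k; exact: measurable_Th. Qed.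

Lemma TjS n (w : Om) : Tj n.+1 w = (Tj n w + Th n.+1 w)%E.
Proof. by rewrite /Tj big_nat_recr. Qed.

(** Sojourns may be any extended reals, so [Tj n w < +oo] would let in paths with [Tj n w = -oo].
    Finiteness says exactly that the first n sojourns are finite ([aliveS]). *)
Definition alive n : set Om := [set w | Tj n w \is a fin_num].

Lemma measurable_alive n : measurable (alive n).
Proof.
rewrite -[X in measurable X]setTI.
by apply: emeasurable_fin_num => //; exact: measurable_Tj.
Qed.

Lemma alive0 : alive 0 = setT.
Proof. by apply/seteqP; split=> w //= _; rewrite /alive/= /Tj big_geq. Qed.

Lemma aliveS n w : alive n.+1 w <-> alive n w /\ Th n.+1 w \is a fin_num.
Proof. rewrite {1}/alive/= TjS fin_numD; split=> [/andP[]//|[a b]].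
by apply/andP. Qed.

(** A canonical representative of the history up to n: depending on the history only becomes
    invariance under [trunc n]. At index 0 the state is kept and the dummy time reset, in accordance
    with [is_policy] and [hist_set], which compare only states there. *)
Definition trunc n (w : Om) : Om :=
  fun k => if (0 < k <= n)%N then w k else (0%E, X 0 w).

Lemma truncE n w k : trunc n w k = if (0 < k <= n)%N then w k else (0%E, X 0 w).
Proof. by []. Qed.

Lemma X_trunc n w k : (k <= n)%N -> X k (trunc n w) = X k w.
Proof.
move=> kn; rewrite /X truncE kn andbT; case: ifP => //.
by case: k kn.
Qed.

Lemma Tj_trunc n w : Tj n (trunc n w) = Tj n w.
Proof.
rewrite /Tj big_seq [RHS]big_seq; apply: eq_bigr => k.
by rewrite mem_index_iota ltnS => kn; rewrite /Th truncE kn.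
Qed.

Lemma alive_trunc n w : alive n (trunc n w) = alive n w.
Proof. by rewrite /alive/= Tj_trunc. Qed.

Lemma eq_trunc n (w w' : Om) : X 0 w = X 0 w' ->
  (forall k, (0 < k <= n)%N -> w k = w' k) -> trunc n w = trunc n w'.
Proof.
move=> w0 ww; apply/funext => k; rewrite !truncE w0.
by case: ifP => // /ww.
Qed.

Lemma measurable_trunc n : measurable_fun setT (trunc n).
Proof.
apply: measurable_to_Omega => k; rewrite (_ : (fun _ => _) =
  (fun w : Om => if (0 < k <= n)%N then w k else (0%E, X 0 w))) //.
case: (0 < k <= n)%N; first exact: measurable_coord.
by apply: measurable_fun_pair => //; exact: measurable_X.
Qed.

Lemma hist_set_trunc n (U : set Om) : measurable U -> hist_set n (trunc n @^-1` U).
Proof.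
move=> mU; split; first by rewrite -[X in measurable X]setTI; exact: measurable_trunc.
by move=> w w' w0 ww; rewrite /= (eq_trunc w0 ww).
Qed.

Lemma trunc_history n (w : Om) : X 0 w = X 0 (trunc n w) /\
  forall k, (0 < k <= n)%N -> w k = trunc n w k.
Proof. by split=> [|k kn]; rewrite ?X_trunc// truncE kn. Qed.

Lemma measurable_ThU n t : measurable [set w : Om | t%:E <= Th n.+1 w]%E.
Proof.
rewrite -[X in measurable X]setTI.
by apply: measurable_lee => //; exact: measurable_Th.
Qed.

End trajectories.

(** * Tonelli on subdomains, negligible sets, and uniqueness of measures on a product with the
    line *)

Lemma fubini_tonelli_in d1 d2 (T1 : measurableType d1) (T2 : measurableType d2)
    (R : realType) (m1 : {sigma_finite_measure set T1 -> \bar R})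
    (m2 : {sigma_finite_measure set T2 -> \bar R}) (D1 : set T1) (D2 : set T2)
    (f : T1 * T2 -> \bar R) :
  measurable D1 -> measurable D2 ->
  measurable_fun setT f -> (forall z, 0 <= f z)%E ->
  (\int[m1]_(x in D1) \int[m2]_(y in D2) f (x, y) =
   \int[m2]_(y in D2) \int[m1]_(x in D1) f (x, y))%E.
Proof.
move=> mD1 mD2 mf f0.
pose g z := (f z * (\1_(D1 `*` D2) z)%:E)%E.
have mg : measurable_fun setT g.
  apply: emeasurable_funM => //.
  by apply/measurable_EFinP/measurable_indic; exact: measurableX.
have g0 z : (0 <= g z)%E by rewrite mule_ge0// lee_fin.
transitivity (\int[m1]_x \int[m2]_y g (x, y))%E.
  rewrite integral_mkcond; apply: eq_integral => x _; rewrite patchE.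
  case: ifPn => xD; last first.
    rewrite integral0_eq// => y _; rewrite /g indicE.
    by rewrite memNset ?mule0// => -[/= /mem_set]; rewrite (negbTE xD).
  rewrite [LHS]integral_mkcond; apply: eq_integral => y _; rewrite patchE /g indicE.
  rewrite in_setX/= xD/=; case: ifP => _; by rewrite ?mule1 ?mule0.
rewrite fubini_tonelli//.
rewrite [RHS]integral_mkcond; apply: eq_integral => y _; rewrite patchE.
case: ifPn => yD; last first.
  rewrite integral0_eq// => x _; rewrite /g indicE.
  by rewrite memNset ?mule0// => -[/= _ /mem_set]; rewrite (negbTE yD).
rewrite [RHS]integral_mkcond; apply: eq_integral => x _; rewrite patchE /g indicE.
by rewrite in_setX/= yD andbT; case: ifP => _; rewrite ?mule1 ?mule0.
Qed.

Lemma measurable_fun_fubini_in d1 d2 (T1 : measurableType d1) (T2 : measurableType d2)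
    (R : realType) (m2 : {sigma_finite_measure set T2 -> \bar R}) (D2 : set T2)
    (f : T1 * T2 -> \bar R) :
  measurable D2 -> measurable_fun setT f -> (forall z, 0 <= f z)%E ->
  measurable_fun setT (fun x => \int[m2]_(y in D2) f (x, y))%E.
Proof.
move=> mD2 mf f0.
pose g z := (f z * (\1_D2 z.2)%:E)%E.
have mg : measurable_fun setT g.
  apply: emeasurable_funM => //; apply/measurable_EFinP.
  by apply: measurableT_comp => //; exact: measurable_indic.
have g0 z : (0 <= g z)%E by rewrite mule_ge0// lee_fin.
rewrite (_ : (fun _ => _) = fubini_F m2 g).
  exact: measurable_fun_fubini_tonelli_F.
apply/funext => x; rewrite /fubini_F [LHS]integral_mkcond.
apply: eq_integral => y _; rewrite patchE /g indicE/=.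
by case: ifP => _; rewrite ?mule1 ?mule0.
Qed.

Lemma ge0_integral_eq_off_countable (R : realType) (D C : set R) (f g : R -> \bar R) :
  measurable D -> countable C -> measurable_fun D f -> measurable_fun D g ->
  (forall t, D t -> 0 <= f t)%E -> (forall t, D t -> 0 <= g t)%E ->
  (forall t, D t -> ~ C t -> f t = g t) ->
  (\int[lebesgue_measure]_(t in D) f t = \int[lebesgue_measure]_(t in D) g t)%E.
Proof.
move=> mD cC mf mg f0 g0 fg; apply: ge0_ae_eq_integral => //.
exists C; split.
- exact: countable_measurable.
- exact: countable_lebesgue_measure0.
- by move=> t /= /not_implyP[Dt]; apply: contra_notP => nC; exact: fg.
Qed.

Lemma nneseries_single (R : realType) (u : nat -> \bar R) (n : nat) :
  (forall m, 0 <= u m)%E -> (forall m, m != n -> u m = 0%E) ->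
  (\sum_(m <oo) u m = u n)%E.
Proof.
move=> u0 un; rewrite (@nneseriesD1 _ _ n xpredT)//.
by rewrite eseries0 ?adde0// => m _ /andP[_ /un].
Qed.

Lemma fin_num_addeI (R : realType) (a b c : \bar R) :
  a \is a fin_num -> (a + b = a + c)%E -> b = c.
Proof.
case: a => // r _; case: b => [b| |]; case: c => [c| |] //=.
by rewrite -!EFinD => -[/addrI ->].
Qed.

Lemma measurable_prod_rays d (T : measurableType d) (R : realType) :
  @measurable _ (T * R)%type =
  <<s [set U `*` `]-oo, t[%classic | U in measurable & t in [set: R]] >>.
Proof.
set G := (X in <<s X >>); rewrite eqEsubset; split.
  rewrite measurable_prod_measurableType; apply: smallest_sub.
    exact: smallest_sigma_algebra.
  move=> _ [B mB] [C mC] <-.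
  pose GT := g_sigma_algebraType G.
  have m1 : measurable (fst @^-1` B : set GT).
    rewrite (_ : _ @^-1` _ = \bigcup_n (B `*` `]-oo, n%:R[%classic)).
      apply: bigcupT_measurable => n; apply: sub_sigma_algebra.
      by exists B => //; exists n%:R.
    apply/seteqP; split=> [[x r] /= Bx|[x r] [n _ []]//].
    exists (Num.truncn `|r|).+1 => //; split=> //=; rewrite in_itv/=.
    by rewrite (le_lt_trans (ler_norm r))// truncnS_gt.
  have m2 : measurable_fun setT (snd : GT -> R).
    apply: (measurability _ (RGenInftyO.measurableE R)).
    move=> _ [_ [t ->] <-]; apply: sub_sigma_algebra.
    exists setT => //; exists t => //.
  rewrite (_ : B `*` C = (fst @^-1` B) `&` (setT `&` snd @^-1` C)).
    by apply: (@measurableI _ GT) => //; exact: m2.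
  by apply/seteqP; split=> -[x r] /= [] // ? [].
apply: smallest_sub; first exact: sigma_algebra_measurable.
by move=> _ [U mU] [t _] <-; exact: measurableX.
Qed.

(** The law of a sojourn is prescribed through its tails [t <= Th], whose complements are open left
    rays. The products of measurable sets with such rays are stable under intersection and generate
    the product sigma-algebra. *)
Lemma finite_measure_unique_rays d (T : measurableType d) (R : realType)
    (m1 m2 : {measure set (T * R) -> \bar R}) :
  (forall U t, measurable U -> m1 (U `*` `]-oo, t[%classic) = m2 (U `*` `]-oo, t[%classic)) ->
  (m1 setT < +oo)%E -> forall B, measurable B -> m1 B = m2 B.
Proof.
move=> E fin1 B mB.
apply: (@measure_unique _ R _ _ (fun k : nat => [set: T] `*` `]-oo, (k%:R : R)[%classic)
  (@measurable_prod_rays d T R) _ _ _ m1 m2 _ _ B mB).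
- move=> _ _ [U mU [s _ <-]] [V mV [t _ <-]].
  exists (U `&` V); first exact: measurableI.
  exists (Order.min s t) => //; rewrite -setXI; congr (_ `*` _).
  by apply/seteqP; split=> r /=; rewrite !in_itv/= lt_min => /andP.
- by move=> k; exists setT => //; exists k%:R.
- apply/seteqP; split=> // -[x r] _; exists (Num.truncn `|r|).+1 => //.
  by split=> //=; rewrite in_itv/= (le_lt_trans (ler_norm r))// truncnS_gt.
- by move=> _ [U mU [t _ <-]]; exact: E.
- move=> k; apply: le_lt_trans fin1; apply: le_measure; rewrite ?inE//.
  exact: measurableX.
Qed.

(** * Law of the sojourns *)

Lemma measurable_fun_uncurried d1 d2 d3 d4 (T1 : measurableType d1)
    (T2 : measurableType d2) (T3 : measurableType d3) (T4 : measurableType d4)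
    (f : T1 -> T2 -> T3) (g : T4 -> T1) (h : T4 -> T2) :
  measurable_fun setT (fun xa : T1 * T2 => f xa.1 xa.2) ->
  measurable_fun setT g -> measurable_fun setT h ->
  measurable_fun setT (fun z => f (g z) (h z)).
Proof. by move=> mf mg mh; exact: (measurableT_comp mf (measurable_fun_pair mg mh)). Qed.

Lemma measurable_fun_dirac_at d1 d2 (T1 : measurableType d1) (T2 : measurableType d2)
    (R : realType) (g : T1 -> T2) (U : set T2) :
  measurable_fun setT g -> measurable U ->
  measurable_fun setT (fun y => \d_(g y) U : \bar R).
Proof.
move=> mg mU; rewrite (_ : (fun _ => _) = EFin \o (\1_(g @^-1` U) : T1 -> R)).
  apply/measurable_EFinP/measurable_indic.
  by rewrite -[X in measurable X]setTI; exact: mg.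
by apply/funext => y /=; rewrite diracE indicE.
Qed.

Section action_integral.
Context (R : realType) (S A : ptopologicalType).
Local Notation Sm := (borel S).
Local Notation Am := (borel A).
Local Notation Om := (Omega R S).
Variable p : policy R S A.
Hypothesis hp : is_policy p.

Let p1 n w s : p n w s setT = 1%E. Proof. by case: hp => + _ _; apply. Qed.

Let p_trunc n w s U : p n w s U = p n (trunc n w) s U.
Proof.
case: hp => _ + _; have [h1 h2] := trunc_history n w.
by apply => // k /h2.
Qed.

Let mp n (U : set Am) : measurable U ->
  measurable_fun setT (fun ws : Om * R => p n ws.1 ws.2 U).
Proof. by case: hp => _ _; apply. Qed.

Definition actint (f : Sm -> Am -> \bar R) n w s := (\int[p n w s]_a f (X n w) a)%E.

Lemma actint_trunc f n w s : actint f n w s = actint f n (trunc n w) s.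
Proof.
rewrite /actint X_trunc//; apply: eq_measure_integral => U mU _.
exact: p_trunc.
Qed.

Section actint.
Variable f : Sm -> Am -> \bar R.
Hypothesis mf : measurable_fun setT (fun xa : Sm * Am => f xa.1 xa.2).
Hypothesis f0 : forall x a, (0 <= f x a)%E.

Lemma actint_ge0 n w s : (0 <= actint f n w s)%E.
Proof. by apply: integral_ge0 => a _. Qed.

Lemma measurable_actint n :
  measurable_fun setT (fun ws : Om * R => actint f n ws.1 ws.2).
Proof.
apply: (@measurable_fun_integral_prob _ _ (Om * R)%type Am R
  (fun ws => p n ws.1 ws.2) _ _ (fun z => f (X n z.1.1) z.2)) => //.
- by move=> U; exact: mp.
- apply: measurable_fun_uncurried => //.
  exact: (measurableT_comp (measurable_X n) (measurableT_comp measurable_fst measurable_fst)).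
Qed.

End actint.

End action_integral.

(** * The cost of a single path, sojourn by sojourn *)

Section path.
Context (R : realType) (S : ptopologicalType) (w : Omega R S).
Local Notation leb := (@lebesgue_measure R).
Hypothesis Th_gt0 : forall n, alive n w -> (0 < Th n.+1 w)%E.

Lemma Tj_le j k : (j <= k)%N -> alive k w -> (Tj j w <= Tj k w)%E.
Proof.
elim: k => [|k ih]; first by rewrite leqn0 => /eqP ->.
rewrite leq_eqVlt => /predU1P[->//|jk] /aliveS[ak _].
by apply: le_trans (ih jk ak) _; rewrite TjS leeDl// ltW// Th_gt0.
Qed.

Lemma Tj_ge0 k : alive k w -> (0 <= Tj k w)%E.
Proof. by move=> /(Tj_le (leq0n k)); rewrite /Tj big_geq. Qed.

(* After an infinite sojourn the jump times are [+oo], or [-oo] since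
   [+oo + -oo = -oo]; neither brackets a real time. *)
Lemma alive_of_bracket n t : (Tj n w <= t%:E)%E -> (t%:E <= Tj n.+1 w)%E -> alive n w.
Proof.
move=> le1 le2; rewrite /alive/= fin_numE; apply/andP; split; apply/eqP => E.
  by rewrite TjS E addNye leeNy_eq in le2.
by rewrite E leye_eq in le1.
Qed.

(** [rate] has two indices because the state is right-continuous in time and the action
    left-continuous. The two brackets select the same index except at jump times, a countable set.
    Positive sojourns order the jump times and so exclude a second bracket. *)
Lemma rate_off_jumps (A : ptopologicalType) (p : policy R S A)
    (f : borel S -> borel A -> \bar R) t :
  (forall x a, 0 <= f x a)%E -> ~ [set fine (Tj k w) | k in [set: nat]] t ->
  rate p f w t = (\sum_(n <oo) (if Tj n w < t%:E < Tj n.+1 w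
    then actint p f n w (t - fine (Tj n w)) else 0))%E.
Proof.
move=> f0 nC; apply: eq_eseriesr => n _.
have neq k : alive k w -> Tj k w != t%:E.
  by move=> ak; apply/eqP => E; apply: nC; exists k => //; rewrite E.
have [/andP[Tn tT]|F] := boolP (Tj n w <= t%:E < Tj n.+1 w)%E; last first.
  rewrite eseries0 //; case: ifP => // /andP[Tn tT].
  by rewrite (ltW Tn) tT in F.
have an := alive_of_bracket Tn (ltW tT).
rewrite (@nneseries_single _ _ n); first last.
- move=> m mn /=; case: ifP => // /andP[Tm tTm].
  have am := alive_of_bracket (ltW Tm) tTm.
  have [lt|gt|E] := ltngtP m n.
  + have Tmn := Tj_le lt an.
    have := neq n an; rewrite eq_le Tn/= => /negP[].
    exact: le_trans tTm Tmn.
  + have Tnm := Tj_le gt am.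
    have := lt_le_trans tT Tnm; by rewrite ltNge (ltW Tm).
  + by rewrite E eqxx in mn.
- by move=> m; case: ifP => // _; apply: integral_ge0 => a _.
have Tn' : (Tj n w < t%:E)%E by rewrite lt_neqAle neq.
by rewrite /= Tn' tT (ltW tT).
Qed.

(** Time is counted from the last jump, and the condition becomes [s <= Th], the event whose
    probability [strategic] gives. *)
Lemma sojourn_shift n (F : R -> \bar R) : alive n w ->
  measurable_fun setT F -> (forall s, 0 <= F s)%E ->
  (\int[leb]_(t in `[0%R, +oo[) (if Tj n w < t%:E < Tj n.+1 w
     then F (t - fine (Tj n w))%R else 0) =
   \int[leb]_(s in `[0%R, +oo[) (if s%:E <= Th n.+1 w then F s else 0))%E.
Proof.
move=> an mF F0; rewrite TjS.
have := Tj_ge0 an; rewrite -(fineK an) lee_fin/=; set c := fine _ => c0.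
pose g s : \bar R := if (0%:E < s%:E)%E && (s%:E < Th n.+1 w)%E then F s else 0%E.
have mg : measurable_fun setT g.
  apply: measurable_fun_ifT => //; apply: measurable_and;
    by apply: measurable_fun_lte => //; exact/measurable_EFinP.
have g0 s : (0 <= g s)%E by rewrite /g; case: ifP.
transitivity (\int[leb]_t g (t - c)%R)%E.
  rewrite [LHS]integral_mkcond; apply: eq_integral => t _; rewrite patchE.
  rewrite mem_setE in_itv/= andbT /g !lte_fin subr_gt0.
  have -> : (t%:E < c%:E + Th n.+1 w)%E = ((t - c)%:E < Th n.+1 w)%E.
    case: (Th n.+1 w) => [r| |]; first by rewrite -EFinD !lte_fin ltrBlDl.
      by rewrite addey// !ltry.
    by rewrite addeNy !ltNge !leNye.
  case: ifPn => //; rewrite -ltNge => t0.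
  by rewrite ltNge (ltW (lt_le_trans t0 c0)).
rewrite ge0_integral_translation//.
transitivity (\int[leb]_(s in `[0%R, +oo[) g s)%E.
  rewrite [RHS]integral_mkcond; apply: eq_integral => s _; rewrite patchE.
  rewrite mem_setE in_itv/= andbT; case: ifPn => //; rewrite -ltNge => s0.
  by rewrite /g lte_fin ltNge (ltW s0).
(* The strict and the weak bounds differ only at the two ends of the sojourn. *)
apply: (@ge0_integral_eq_off_countable _ _ [set 0%R; fine (Th n.+1 w)]) => //.
- exact/finite_set_countable.
- exact: measurable_funTS.
- apply: measurable_funTS; apply: measurable_fun_ifT => //.
  by apply: measurable_fun_lee => //; exact/measurable_EFinP.
- by move=> s _; case: ifP.
- move=> s /=; rewrite in_itv/= andbT => s0 /not_orP[/eqP sn0 sT].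
  rewrite /g lte_fin lt_neqAle eq_sym sn0 s0/=.
  rewrite [in RHS]le_eqVlt; case: eqP => // E; exfalso; apply: sT.
  by rewrite -E.
Qed.

Lemma path_cost (A : ptopologicalType) (p : policy R S A)
    (f : borel S -> borel A -> \bar R) :
  is_policy p ->
  measurable_fun setT (fun xa : borel S * borel A => f xa.1 xa.2) ->
  (forall x a, 0 <= f x a)%E ->
  measurable_fun setT (rate p f w) ->
  (\int[leb]_(t in `[0%R, +oo[) rate p f w t = \sum_(n <oo) ((\1_(alive n) w)%:E *
    \int[leb]_(s in `[0%R, +oo[) (if s%:E <= Th n.+1 w then actint p f n w s else 0)))%E.
Proof.
move=> hp mf f0 mr.
have mact n : measurable_fun setT (actint p f n w).
  exact: (measurableT_comp (measurable_actint hp mf f0 n) (pair1_measurable w)).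
have mterm n : measurable_fun setT (fun t : R => if (Tj n w < t%:E < Tj n.+1 w)%E
    then actint p f n w (t - fine (Tj n w)) else 0%E).
  apply: measurable_fun_ifT => //.
    by apply: measurable_and; apply: measurable_fun_lte => //; exact/measurable_EFinP.
  by apply: measurableT_comp => //; exact: measurable_funB.
have term0 n t : (0 <= if (Tj n w < t%:E < Tj n.+1 w)%E
    then actint p f n w (t - fine (Tj n w)) else 0)%E.
  by case: ifP => // _; exact: actint_ge0.
transitivity (\int[leb]_(t in `[0%R, +oo[) \sum_(n <oo) (if Tj n w < t%:E < Tj n.+1 w
    then actint p f n w (t - fine (Tj n w))%R else 0))%E.
  apply: (@ge0_integral_eq_off_countable _ _ [set fine (Tj k w) | k in [set: nat]]) => //.
  - exact: (sub_countable (card_image_le _ _)).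
  - exact: measurable_funTS.
  - by apply: measurable_funTS; apply: ge0_emeasurable_sum.
  - move=> t _; apply: nneseries_ge0 => n _ _; apply: nneseries_ge0 => m _ _.
    by case: ifP => // _; apply: integral_ge0 => a _.
  - by move=> t _; apply: nneseries_ge0 => n _ _.
  - by move=> t _ nC; exact: rate_off_jumps.
rewrite integral_nneseries; last 3 first.
- exact: measurable_itv.
- by move=> n; apply: measurable_funTS; exact: mterm.
- by move=> n t _; exact: term0.
apply: eq_eseriesr => n _; rewrite indicE.
have [an|nan] := boolP (w \in alive n).
  rewrite mul1e (sojourn_shift (set_mem an))//.
  by move=> s; exact: actint_ge0.
rewrite mul0e integral0_eq// => t _; case: ifP => // /andP[Tn tT].
by rewrite (mem_set (alive_of_bracket (ltW Tn) (ltW tT))) in nan.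
Qed.

End path.

(** * Conditional laws and expected costs under a strategic measure *)

Section strategic_measure.
Context (R : realType) (S A : ptopologicalType).
Local Notation Sm := (borel S).
Local Notation Am := (borel A).
Local Notation Om := (Omega R S).
Local Notation leb := (@lebesgue_measure R).
Variables (qt : Sm -> Am -> {measure set Sm -> \bar R}) (qx : S -> A -> R).
Hypothesis mqt : forall G : set Sm, measurable G ->
  measurable_fun setT (fun xa : Sm * Am => qt xa.1 xa.2 G).
Hypothesis mqx : measurable_fun setT (fun xa : Sm * Am => qx xa.1 xa.2).
Hypothesis qx0 : forall x a, 0 <= qx x a.
Hypothesis qxbd : forall x, exists M : R, forall a, qx x a <= M.
Hypothesis qtT : forall x a, qt x a setT = (qx x a)%:E.
Variables (gam : {measure set Sm -> \bar R}) (p : policy R S A) (P : probability Om R).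
Hypothesis hp : is_policy p.
Hypothesis hP : strategic qt qx gam p P.

Local Notation actint := (actint p).

Let p1 n w s : p n w s setT = 1%E. Proof. by case: hp => + _ _; apply. Qed.

Let mp n (U : set Am) : measurable U ->
  measurable_fun setT (fun ws : Om * R => p n ws.1 ws.2 U).
Proof. by case: hp => _ _; apply. Qed.

Let qE : Sm -> Am -> \bar R := fun x a => (qx x a)%:E.
Let mqE : measurable_fun setT (fun xa : Sm * Am => qE xa.1 xa.2).
Proof. exact/measurable_EFinP. Qed.
Let qE0 x a : (0 <= qE x a)%E. Proof. by rewrite lee_fin. Qed.

Definition lam n w s : R := fine (actint qE n w s).
Definition surv n w t : R := expR (- \int[leb]_(s in `[0, t]) lam n w s).

Let actint_le n w s M : (forall a, qx (X n w) a <= M) -> (actint qE n w s <= M%:E)%E.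
Proof.
move=> qM; apply: (@le_trans _ _ (\int[p n w s]_a (cst M%:E) a))%E.
  apply: ge0_le_integral => //.
    exact: (measurableT_comp mqE (pair1_measurable (X n w))).
  by move=> a _; rewrite lee_fin.
by rewrite integral_cst// p1 mule1.
Qed.

Lemma lamE n w s : actint qE n w s = (lam n w s)%:E.
Proof.
rewrite /lam fineK// ge0_fin_numE ?actint_ge0//.
by have [M qM] := qxbd (X n w); rewrite (le_lt_trans (actint_le _ qM))// ltry.
Qed.

Lemma lam_ge0 n w s : 0 <= lam n w s.
Proof. by rewrite -lee_fin -lamE actint_ge0. Qed.

Lemma lam_bd n w : exists M, forall s, lam n w s <= M.
Proof.
have [M qM] := qxbd (X n w); exists M => s; rewrite -lee_fin -lamE.
exact: actint_le.
Qed.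

Lemma lam_trunc n w s : lam n w s = lam n (trunc n w) s.
Proof. by rewrite /lam actint_trunc. Qed.

Lemma measurable_lam n : measurable_fun setT (fun ws : Om * R => lam n ws.1 ws.2).
Proof. by apply: measurableT_comp => //; exact: measurable_actint. Qed.

Lemma measurable_lam1 n w : measurable_fun setT (lam n w).
Proof. exact: (measurableT_comp (measurable_lam n) (pair1_measurable w)). Qed.

Lemma surv_ge0 n w t : 0 <= surv n w t. Proof. exact: expR_ge0. Qed.

Lemma surv0 n w : surv n w 0 = 1.
Proof. by rewrite /surv set_itv1 Rintegral_set1 oppr0 expR0. Qed.

Lemma measurable_surv n : measurable_fun setT (fun ws : Om * R => surv n ws.1 ws.2).
Proof.
do 3 apply: measurableT_comp => //.
apply: (@measurable_fun_cumulative _ Om R (fun ws => (lam n ws.1 ws.2)%:E)).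
  by apply/measurable_EFinP; exact: measurable_lam.
by move=> z; rewrite lee_fin lam_ge0.
Qed.

Lemma survE n w t : expeR (- \int[leb]_(s in `[0%R, t])
  \int[p n w s]_a (qx (X n w) a)%:E)%E = (surv n w t)%:E.
Proof.
have E s : (\int[p n w s]_a (qx (X n w) a)%:E)%E = (lam n w s)%:E by exact: lamE.
under eq_integral do rewrite E.
have [M lM] := lam_bd n w.
by rewrite (hazardE (measurable_lam1 n w) (lam_ge0 n w) lM).
Qed.

Lemma lam_surv_cdf n w t : 0 <= t ->
  (\int[leb]_(s in `[0%R, t]) (lam n w s * surv n w s)%:E)%E = (1 - surv n w t)%:E.
Proof.
have [M lM] := lam_bd n w.
exact: (hazard_ftcE (measurable_lam1 n w) (lam_ge0 n w) lM).
Qed.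

Let alive_ltpinfty n : alive n `&` [set w : Om | (Tj n w < +oo)%E] = alive n.
Proof.
apply/setIidl => w; rewrite /alive/= => H.
by rewrite ltey_eq H.
Qed.

(** [alive n] is itself determined by the history, so it may be intersected with the history set;
    this removes the paths with [Tj n w = -oo]. *)
Lemma survival n (U : set Om) t : measurable U -> 0 <= t ->
  P (trunc n @^-1` U `&` alive n `&` [set w | t%:E <= Th n.+1 w]%E) =
  (\int[P]_(w in trunc n @^-1` U `&` alive n) (surv n w t)%:E)%E.
Proof.
move=> mU t0; case: hP => _ + _.
move=> /(_ n (trunc n @^-1` U `&` alive n) t).
have -> : trunc n @^-1` U `&` alive n `&` [set w | (Tj n w < +oo)%E] =
  trunc n @^-1` U `&` alive n by rewrite -setIA alive_ltpinfty.
move=> -> //.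
  by apply: eq_integral => w _; rewrite survE.
have mUA : measurable (U `&` @alive R S n).
  by apply: measurableI => //; exact: measurable_alive.
have := hist_set_trunc n mUA; congr (hist_set n _).
by rewrite preimage_setI; congr (_ `&` _); apply/seteqP; split=> w /=;
  rewrite alive_trunc.
Qed.

Let mtruncU n (U : set Om) : measurable U -> measurable (trunc n @^-1` U).
Proof. by move=> mU; rewrite -[X in measurable X]setTI; exact: measurable_trunc. Qed.

Let indic_mulE (B : set Om) (U : set Om) n (w : Om) :
  ((\1_B w)%:E * \d_(trunc n w) U)%E = (\1_(trunc n @^-1` U `&` B) w)%:E :> \bar R.
Proof. by rewrite diracE -EFinM !indicE in_setI mulrC -natrM mulnb. Qed.

Let measurable_surv_t n t : measurable_fun setT (fun w : Om => surv n w t).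
Proof. exact: (measurableT_comp (measurable_surv n) (pair2_measurable t)). Qed.

Let mdirac_trunc n (U : set Om) : measurable U ->
  measurable_fun setT (fun w : Om => \d_(trunc n w) U : \bar R).
Proof.
exact: measurable_fun_dirac_at (measurable_trunc n).
Qed.

(** Extends [survival] from history sets to functions of the history, by [mixture_eq] with Dirac
    kernels at [trunc n w]. *)
Lemma survival_fun n t (f : Om -> \bar R) : 0 <= t ->
  measurable_fun setT f -> (forall w, 0 <= f w)%E ->
  (forall w, f w = f (trunc n w)) ->
  (\int[P]_(w in alive n) (if (t%:E <= Th n.+1 w)%E then f w else 0) =
   \int[P]_(w in alive n) ((surv n w t)%:E * f w))%E.
Proof.
move=> t0 mf f0 ft.
pose B := @alive R S n `&` [set w | t%:E <= Th n.+1 w]%E.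
have mB : measurable B by apply: measurableI; [exact: measurable_alive|exact: measurable_ThU].
have mA := @measurable_alive R S n.
pose g1 (w : Om) : R := \1_B w.
pose g2 (w : Om) : R := \1_(alive n) w * surv n w t.
have mg2 : measurable_fun setT g2.
  apply: measurable_funM; first exact: measurable_indic.
  exact: measurable_surv_t.
have g20 w : 0 <= g2 w by rewrite mulr_ge0// surv_ge0.
have mg1 : measurable_fun setT g1 by exact: measurable_indic.
have g10 w : 0 <= g1 w by [].
have H := fun E => @mixture_eq _ _ _ Om Om Om R P P (fun w => \d_(trunc n w))
  (fun w => \d_(trunc n w)) g1 g2 f (@mdirac_trunc n) (@mdirac_trunc n)
  mg1 mg2 g10 g20 E mf f0.
transitivity (\int[P]_w ((g1 w)%:E * \int[\d_(trunc n w)]_z f z))%E.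
  rewrite integral_mkcond; apply: eq_integral => w _.
  rewrite patchE integral_dirac// diracT mul1e -ft /g1 indicE /B in_setI.
  case: (w \in alive n) => /=; last by rewrite mul0e.
  have -> : (w \in [set w0 | t%:E <= Th n.+1 w0]%E) = (t%:E <= Th n.+1 w)%E.
    by apply/idP/idP; rewrite inE.
  by case: ifP => _; rewrite ?mul1e ?mul0e.
rewrite H.
- rewrite [RHS]integral_mkcond; apply: eq_integral => w _.
  rewrite patchE integral_dirac// diracT mul1e -ft /g2 indicE.
  by case: (w \in alive n); rewrite ?mul1r// mul0r mul0e.
- move=> U mU.
  transitivity (P (trunc n @^-1` U `&` alive n `&` [set w | t%:E <= Th n.+1 w]%E)).
    rewrite -setIA -/B -[X in P X]setIT -integral_indic//; last first.
      by apply: measurableI => //; exact: mtruncU.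
    by apply: eq_integral => w _; rewrite /g1 indic_mulE.
  rewrite survival// [LHS]integral_mkcond; apply: eq_integral => w _.
  transitivity ((g2 w)%:E * ((trunc n w \in U)%:R)%:E)%E; last by [].
  rewrite patchE /g2 in_setI -EFinM indicE.
  have -> : (w \in trunc n @^-1` U) = (trunc n w \in U) by [].
  by case: (w \in alive n); case: (trunc n w \in U); rewrite ?mul1r ?mul0r ?mulr1 ?mulr0.
Qed.

(** The tail formula for a cost accumulated up to a random time: Tonelli brings time outside, and
    [survival_fun] is applied at each fixed time. *)
Lemma survival_integral n (f : Om * R -> \bar R) :
  measurable_fun setT f -> (forall z, 0 <= f z)%E ->
  (forall w s, f (w, s) = f (trunc n w, s)) ->
  (\int[P]_(w in alive n) \int[leb]_(s in `[0%R, +oo[)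
     (if (s%:E <= Th n.+1 w)%E then f (w, s) else 0) =
   \int[P]_(w in alive n) \int[leb]_(s in `[0%R, +oo[)
     ((surv n w s)%:E * f (w, s)))%E.
Proof.
move=> mf f0 ft.
have mA := @measurable_alive R S n.
rewrite (fubini_tonelli_in P leb (f := fun z : Om * R =>
  if (z.2%:E <= Th n.+1 z.1)%E then f z else 0%E))//; last 2 first.
- apply: measurable_fun_ifT => //; apply: measurable_fun_lee.
    by apply/measurable_EFinP.
  by apply: measurableT_comp => //; exact: measurable_Th.
- by move=> z; case: ifP.
rewrite (fubini_tonelli_in P leb (f := fun z : Om * R =>
  ((surv n z.1 z.2)%:E * f z)%E))//; last 2 first.
- apply: emeasurable_funM => //; apply/measurable_EFinP; exact: measurable_surv.
- by move=> z; rewrite mule_ge0// lee_fin surv_ge0.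
apply: eq_integral => s; rewrite inE/= in_itv/= andbT => s0.
rewrite survival_fun//.
exact: (measurableT_comp mf (pair2_measurable s)).
Qed.

#[local] Hint Resolve lam_ge0 measurable_lam measurable_lam1 measurable_surv : core.

Let mfineTh n t : measurable [set w : Om | fine (Th n.+1 w) < t]%R.
Proof.
rewrite (_ : [set _ | _] = ~` (setT `&` [set w : Om | t <= fine (Th n.+1 w)])).
  apply: measurableC; apply: measurable_fun_le => //.
  by apply: measurableT_comp => //; exact: measurable_Th.
by rewrite setTI; apply/seteqP; split=> w /=; rewrite ltNge => /negP.
Qed.

Let B0 n := @alive R S n `&` [set w | Th n.+1 w < 0]%E.

Let mB0 n : measurable (B0 n).
Proof.
apply: measurableI; first exact: measurable_alive.
by rewrite -[X in measurable X]setTI; apply: measurable_lte => //; exact: measurable_Th.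
Qed.

(** At t = 0 the survival function is 1, so [Th >= 0] has the full probability of [alive n]. *)
Lemma sojourn_lt0_null n : P (B0 n) = 0%E.
Proof.
have mA := @measurable_alive R S n.
have := @survival n setT 0 measurableT (lexx _).
rewrite preimage_setT setTI; under eq_integral do rewrite surv0.
rewrite integral_cst// mul1e => E.
have : P (alive n) = (P (alive n `&` [set w | 0 <= Th n.+1 w]%E) + P (B0 n))%E.
  rewrite -measureU//.
  - congr (P _); rewrite -setIUr; apply/esym/setIidl => w _ /=.
    by case: (leP 0%E (Th n.+1 w)) => _; [left|right].
  - by apply: measurableI => //; exact: measurable_ThU.
  - apply/seteqP; split=> w //= -[[_ +] [_]] /=.
    by move=> /le_lt_trans/[apply]; rewrite ltxx.
rewrite E -[in LHS](adde0 (P (alive n))) => /fin_num_addeI <-//.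
exact: fin_num_measure.
Qed.

(** Up to the null set [B0 n], a path alive at n either has [t <= Th] or ends its sojourn before t,
    and is then alive at n + 1. *)
Let ray_split n (U : set Om) t : measurable U -> 0 <= t ->
  (P (alive n.+1 `&` (trunc n @^-1` U `&` [set w | fine (Th n.+1 w) < t]%R)) +
   \int[P]_(w in trunc n @^-1` U `&` alive n) (surv n w t)%:E =
   P (trunc n @^-1` U `&` alive n))%E.
Proof.
move=> mU t0; rewrite -survival//.
have mA := @measurable_alive R S n; have mA1 := @measurable_alive R S n.+1.
have mT := @measurable_ThU R S n t.
have mV : measurable (trunc n @^-1` U `&` alive n).
  by apply: measurableI => //; exact: mtruncU.
have mW := mfineTh n t.
set C := alive n.+1 `&` _.
have mC : measurable C.
  by apply: measurableI => //; apply: measurableI => //; exact: mtruncU.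
rewrite -measureU//; last first.
- apply/seteqP; split=> w //= -[[/aliveS[_ h] [_ /= lt]] [_ /=]].
  by rewrite -(fineK h) lee_fin leNgt lt.
- exact: measurableI.
apply/eqP; rewrite eq_le; apply/andP; split.
  apply: le_measure; rewrite ?inE//.
    by apply: measurableU => //; exact: measurableI.
  by move=> w [[/aliveS[? _] [? _]]|[]].
have -> : P (trunc n @^-1` U `&` alive n) = P ((trunc n @^-1` U `&` alive n) `\` B0 n).
  rewrite measureD//; last by rewrite ltey_eq fin_num_measure.
  transitivity (P (trunc n @^-1` U `&` alive n) - 0)%E; first by rewrite sube0.
  congr (_ - _)%E; apply/esym.
  apply: (@subset_measure0 _ _ _ P _ (B0 n)) => //; first exact: measurableI.
  exact: sojourn_lt0_null.
apply: le_measure; rewrite ?inE//.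
- exact: measurableD.
- by apply: measurableU => //; exact: measurableI.
- move=> w [[Uw aw] nB].
  have Th0 : (0 <= Th n.+1 w)%E by rewrite leNgt; apply/negP => lt; apply: nB.
  case: (leP t%:E (Th n.+1 w)) => lt; [by right|left; split].
    apply/aliveS; split=> //; rewrite ge0_fin_numE//.
    exact: lt_trans lt (ltry _).
  split=> //=; rewrite -lte_fin fineK// ge0_fin_numE//.
  exact: lt_trans lt (ltry _).
Qed.

(** Given the history, the sojourn has density [lam * surv]. Both sides are integrals against
    measures on histories and times, [m1] and [m2], compared on rays: below time t the density has
    mass 1 - [surv], by [hazard_ftc], and [ray_split] yields the same for the law. *)
Lemma sojourn_law n (h : Om * R -> \bar R) :
  measurable_fun setT h -> (forall z, 0 <= h z)%E ->
  (forall w s, h (w, s) = h (trunc n w, s)) ->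
  (\int[P]_(w in alive n.+1) h (w, fine (Th n.+1 w)) =
   \int[P]_(w in alive n) \int[leb]_(s in `[0%R, +oo[)
     ((lam n w s * surv n w s)%:E * h (w, s)))%E.
Proof.
move=> mh h0 ht.
have mA := @measurable_alive R S n; have mA1 := @measurable_alive R S n.+1.
pose j1 (w : Om) : Om * R := (trunc n w, fine (Th n.+1 w)).
have mj1 : measurable_fun setT j1.
  apply: measurable_fun_pair; first exact: measurable_trunc.
  by apply: measurableT_comp => //; exact: measurable_Th.
pose j2 (ws : Om * R) : Om * R := (trunc n ws.1, ws.2).
have mj2 : measurable_fun setT j2.
  by apply: measurable_fun_pair => //; apply: measurableT_comp => //; exact: measurable_trunc.
pose g1 (w : Om) : R := \1_(alive n.+1) w.
pose g2 (ws : Om * R) : R :=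
  \1_(alive n) ws.1 * \1_(`[0, +oo[%classic) ws.2 * (lam n ws.1 ws.2 * surv n ws.1 ws.2).
have mg1 : measurable_fun setT g1 by exact: measurable_indic.
have g10 w : 0 <= g1 w by [].
have mg2 : measurable_fun setT g2.
  apply: measurable_funM; apply: measurable_funM => //.
    by apply: measurableT_comp => //; exact: measurable_indic.
  by apply: measurableT_comp => //; exact: measurable_indic.
have g20 z : 0 <= g2 z by rewrite !mulr_ge0// expR_ge0.
have [m1 [m1E m1I]] := @weighted_mixture _ _ Om _ R P (fun w => \d_(j1 w)) g1
  (fun U mU => measurable_fun_dirac_at mj1 mU) mg1 g10.
have [m2 [m2E m2I]] := @weighted_mixture _ _ _ _ R (P \x leb)%E (fun z => \d_(j2 z)) g2
  (fun U mU => measurable_fun_dirac_at mj2 mU) mg2 g20.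
have int2 (f : Om * R -> \bar R) : measurable_fun setT f -> (forall z, 0 <= f z)%E ->
    (forall w s, f (w, s) = f (trunc n w, s)) ->
    (\int[P \x leb]_z ((g2 z)%:E * f (j2 z)) = \int[P]_(w in alive n)
      \int[leb]_(s in `[0%R, +oo[) ((lam n w s * surv n w s)%:E * f (w, s)))%E.
  move=> mf f0 ft; rewrite (@fubini_tonelli1 _ _ _ _ R P leb
    (fun z => (g2 z)%:E * f (j2 z))%E); last 2 first.
  - by apply: emeasurable_funM => //; [exact/measurable_EFinP|exact: measurableT_comp].
  - by move=> z; rewrite mule_ge0// lee_fin.
  rewrite [RHS]integral_mkcond; apply: eq_integral => w _; rewrite patchE /fubini_F.
  case: ifPn => wA; last first.
    by rewrite integral0_eq// => s _; rewrite /g2/= indicE (negbTE wA) !mul0r mul0e.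
  rewrite [RHS]integral_mkcond; apply: eq_integral => s _; rewrite patchE /g2 /j2/=.
  rewrite -ft !indicE wA mul1r; case: ifPn => _; first by rewrite mul1r.
  by rewrite mul0r mul0e.
transitivity (\int[m1]_z h z)%E.
  rewrite m1I// [LHS]integral_mkcond; apply: eq_integral => w _.
  rewrite patchE integral_dirac// diracT mul1e /g1 indicE ht.
  by case: (w \in alive n.+1); rewrite ?mul1e ?mul0e.
transitivity (\int[m2]_z h z)%E; last first.
  rewrite m2I// -int2//; apply: eq_integral => z _.
  by rewrite integral_dirac// diracT mul1e.
apply: eq_measure_integral => B mB _.
apply: finite_measure_unique_rays mB => [U t mU|]; last first.
  rewrite m1E// (le_lt_trans (y := \int[P]_w (cst 1%E w))%E)//.
    apply: ge0_le_integral => //.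
    - by move=> w _; rewrite mule_ge0// lee_fin.
    - apply: emeasurable_funM; first exact/measurable_EFinP.
      exact: measurable_fun_dirac_at.
    - move=> w _; change ((g1 w)%:E * (\1_setT (j1 w))%:E <= 1)%E.
      by rewrite indicT mule1 lee_fin /g1 indicE; case: (w \in _).
  rewrite integral_cst// mul1e ltey_eq; apply/orP; left; exact: fin_num_measure.
have mUt : measurable (U `*` `]-oo, t[%classic : set (Om * R)) by exact: measurableX.
have L : m1 (U `*` `]-oo, t[%classic) =
    P (alive n.+1 `&` (trunc n @^-1` U `&` [set w | fine (Th n.+1 w) < t]%R)).
  rewrite m1E// -[X in P X]setIT -integral_indic//; last first.
    apply: measurableI => //; apply: measurableI; first exact: mtruncU.
    exact: mfineTh.
  apply: eq_integral => w _.
  transitivity ((g1 w)%:E * ((j1 w \in U `*` `]-oo, t[%classic)%:R)%:E)%E; first by [].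
  rewrite -EFinM /g1 !indicE !in_setI -natrM mulnb; congr ((nat_of_bool (_ && _))%:R%:E).
pose f (z : Om * R) : \bar R := (\1_(U `*` `]-oo, t[%classic) z)%:E.
have mf : measurable_fun setT (fun z : Om * R => f (j2 z)).
  apply: (measurableT_comp (f := f)) => //.
  by apply/measurable_EFinP/measurable_indic.
have L2 : m2 (U `*` `]-oo, t[%classic) = (\int[P]_(w in alive n)
      \int[leb]_(s in `[0%R, +oo[) ((lam n w s * surv n w s)%:E * f (j2 (w, s))))%E.
  rewrite m2E// -(int2 (fun z => f (j2 z)))//.
  - apply: eq_integral => z _; congr (_ * _)%E.
    rewrite /j2 /f/= /dirac; congr (_%:E); congr (\1_ _ (_, _)).
    by apply/funext => k; rewrite !truncE; case: ifP.
  - by move=> z; rewrite lee_fin.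
  - move=> w s; rewrite /j2/=; congr (f (_, _)).
    by apply/funext => k; rewrite !truncE; case: ifP.
have [t0|t0] := ltP t 0.
  rewrite L L2 integral0_eq; last first.
    move=> w _; rewrite integral0_eq// => s /=; rewrite in_itv/= andbT => s0.
    rewrite /f indicE memNset ?mule0// => -[_ /=]; rewrite in_itv/=.
    by move=> /(le_lt_trans s0)/(lt_trans t0); rewrite ltxx.
  apply: (@subset_measure0 _ _ _ P _ (B0 n)) => //; last exact: sojourn_lt0_null.
    apply: measurableI => //; apply: measurableI; first exact: mtruncU.
    exact: mfineTh.
  move=> w [/aliveS[aw fw] [_ /= lt]]; split=> //=.
  by rewrite -(fineK fw) lte_fin (lt_trans lt).
have mV : measurable (trunc n @^-1` U `&` alive n).
  by apply: measurableI => //; exact: mtruncU.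
have L3 : m2 (U `*` `]-oo, t[%classic) =
    (\int[P]_(w in trunc n @^-1` U `&` alive n) (1 - surv n w t)%:E)%E.
  rewrite L2 integral_mkcond [RHS]integral_mkcond; apply: eq_integral => w _.
  rewrite !patchE in_setI; case: ifPn => wA; rewrite ?andbF//= andbT.
  have -> : (w \in trunc n @^-1` U) = (trunc n w \in U) by [].
  case: ifPn => wU; last first.
    rewrite integral0_eq// => s _; rewrite /f indicE memNset ?mule0// => -[/= /mem_set].
    by rewrite (negbTE wU).
  rewrite -lam_surv_cdf// [LHS]integral_mkcond -integral_itv_bndo_bndc; last first.
    apply: measurable_funTS; apply/measurable_EFinP; apply: measurable_funM => //.
    exact: (measurableT_comp (measurable_surv n) (pair1_measurable w)).
  rewrite [RHS]integral_mkcond; apply: eq_integral => s _; rewrite !patchE /f indicE.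
  have -> : (j2 (w, s) \in U `*` `]-oo, t[%classic) = (s < t).
    apply/idP/idP => [/set_mem[/= _]|st]; first by rewrite in_itv.
    by apply/mem_set; split=> /=; [exact: set_mem|rewrite in_itv].
  rewrite !mem_setE !in_itv/= andbT.
  by case: (0 <= s); case: (s < t) => /=; rewrite ?mule1 ?mule0.
rewrite L L3.
have := ray_split n mU t0.
have -> : P (trunc n @^-1` U `&` alive n) =
    (\int[P]_(w in trunc n @^-1` U `&` alive n) (1 - surv n w t)%:E +
     \int[P]_(w in trunc n @^-1` U `&` alive n) (surv n w t)%:E)%E.
  rewrite -ge0_integralD//.
  - under eq_integral do rewrite -EFinD subrK.
    by rewrite integral_cst// mul1e.
  - move=> w _; rewrite lee_fin subr_ge0 expR_le1 oppr_le0.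
    exact: Rintegral_ge0.
  - apply/measurable_funTS/measurable_EFinP; exact: measurable_funB.
  - by move=> w _; rewrite lee_fin expR_ge0.
  - exact/measurable_funTS/measurable_EFinP.
(* The mass beyond t is a probability, hence finite, and can be cancelled. *)
move=> H; apply: (@fin_num_addeI _ (\int[P]_(w in trunc n @^-1` U `&` alive n)
  (surv n w t)%:E)%E); last by rewrite addeC H addeC.
rewrite -survival//; apply: fin_num_measure; apply: measurableI => //.
exact: measurable_ThU.
Qed.

(** The prescribed ratio of jump rate to exit rate meets the density [lam * surv] of the sojourn,
    and [lam] cancels. *)
Lemma jump_law n (G : set Sm) : measurable G ->
  P (alive n.+1 `&` X n.+1 @^-1` G) =
  (\int[P]_(w in alive n) \int[leb]_(s in `[0%R, +oo[)
     ((surv n w s)%:E * actint (fun x a => qt x a G) n w s))%E.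
Proof.
move=> mG; pose qG x a := qt x a G.
have mqG : measurable_fun setT (fun xa : Sm * Am => qG xa.1 xa.2) by exact: mqt.
have qG0 x a : (0 <= qG x a)%E by [].
have qGle w s : (actint qG n w s <= (lam n w s)%:E)%E.
  rewrite -lamE; apply: ge0_le_integral => //.
  - exact: (measurableT_comp mqG (pair1_measurable (X n w))).
  - exact: (measurableT_comp mqE (pair1_measurable (X n w))).
  - by move=> a _; rewrite /qE -qtT; apply: le_measure; rewrite ?inE.
pose k w s := fine (actint qG n w s).
have kE w s : actint qG n w s = (k w s)%:E.
  rewrite /k fineK// ge0_fin_numE ?actint_ge0//.
  exact: le_lt_trans (qGle w s) (ltry _).
have k0 w s : 0 <= k w s by rewrite -lee_fin -kE actint_ge0.
pose h (z : Om * R) : \bar R := (k z.1 z.2 / lam n z.1 z.2)%:E.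
have mh : measurable_fun setT h.
  apply/measurable_EFinP; apply: measurable_funM.
    by apply: measurableT_comp => //; exact: measurable_actint.
  (* Inversion agrees with the power of exponent -1 on nonnegative reals, 0 included. *)
  apply: (eq_measurable_fun (fun z : Om * R => lam n z.1 z.2 `^ (-1))).
    by move=> z _; rewrite powR_inv1.
  exact: (measurableT_comp (measurable_powR (-1)) (measurable_lam n)).
have h0 z : (0 <= h z)%E by rewrite lee_fin divr_ge0.
have ht w s : h (w, s) = h (trunc n w, s).
  by rewrite /h/= /k (actint_trunc hp) lam_trunc.
case: hP => _ _ /(_ n (alive n.+1) G) H.
have E : alive n.+1 `&` [set w : Om | (Tj n.+1 w < +oo)%E] = alive n.+1.
  by apply/setIidl => w; rewrite /alive/= => aw; rewrite ltey_eq aw.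
rewrite E in H; rewrite H//; last first.
  split; first exact: measurable_alive.
  move=> w w' w0 ww Tw; rewrite /alive/=.
  rewrite !TjS Tw -(Tj_trunc n w) -(Tj_trunc n w').
  by rewrite (eq_trunc w0 ww).
transitivity (\int[P]_(w in alive n.+1) h (w, fine (Th n.+1 w)))%E; first by [].
rewrite sojourn_law//; apply: eq_integral => w _; apply: eq_integral => s _.
rewrite kE /h/= -!EFinM; congr (_%:E).
(* Where [lam] vanishes the ratio is 0 by convention, and so is the jump rate into [G], being
   dominated by [lam]. *)
have [l0|l0] := eqVneq (lam n w s) 0.
  have -> : k w s = 0.
    by apply/le_anti; rewrite k0 andbT -lee_fin -kE (le_trans (qGle w s))// l0.
  by rewrite !mul0r !mulr0.
by rewrite mulrC mulrA (mulrC _ (k w s)) -!mulrA mulrC; field.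
Qed.

(** The tails alone give [Th >= 0]; the value 0 is excluded because the sojourn has a density, hence
    no atom. *)
Lemma sojourn_le0_null n : P (alive n `&` [set w | Th n.+1 w <= 0]%E) = 0%E.
Proof.
have mA := @measurable_alive R S n; have mA1 := @measurable_alive R S n.+1.
pose h (z : Om * R) : \bar R := (\1_[set s : R | s <= 0] z.2)%:E.
have ms : measurable [set s : R | s <= 0].
  by rewrite -[X in measurable X]setTI; apply: measurable_fun_le.
have mh : measurable_fun setT h.
  by apply/measurable_EFinP; apply: measurableT_comp => //; exact: measurable_indic.
have h0 z : (0 <= h z)%E by rewrite lee_fin.
have mfT : measurable_fun setT (fun w : Om => fine (Th n.+1 w)).
  by apply: measurableT_comp => //; exact: measurable_Th.
have mC : measurable [set w : Om | fine (Th n.+1 w) <= 0].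
  by rewrite -[X in measurable X]setTI; apply: measurable_fun_le.
have := @sojourn_law n h mh h0 (fun w s => erefl).
rewrite [X in _ = X -> _]integral0_eq; last first.
  move=> w _.
  rewrite (@ge0_integral_eq_off_countable _ _ [set 0%R] _ (cst 0%E))//.
  - by rewrite integral0.
  - apply: measurable_funTS; apply: emeasurable_funM.
      apply/measurable_EFinP; apply: measurable_funM => //.
      exact: (measurableT_comp (measurable_surv n) (pair1_measurable w)).
    by apply/measurable_EFinP/measurable_indic.
  - by move=> s _; rewrite mule_ge0// lee_fin mulr_ge0// expR_ge0.
  - move=> s /=; rewrite in_itv/= andbT => s0 sn0; rewrite /h indicE memNset ?mule0//=.
    by move=> s0'; apply: sn0; apply/le_anti; rewrite s0 s0'.
have -> : (\int[P]_(w in alive n.+1) h (w, fine (Th n.+1 w)) =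
    \int[P]_(w in alive n.+1) (\1_[set w : Om | (fine (Th n.+1 w) <= 0)%R] w)%:E)%E.
  by apply: eq_integral => w _; rewrite /h !indicE.
rewrite integral_indic// => E.
have Z : P ((alive n `&` [set w | Th n.+1 w < 0]%E) `|`
    ([set w : Om | fine (Th n.+1 w) <= 0] `&` alive n.+1)) = 0%E.
  apply/eqP; rewrite -measure_le0; apply: le_trans (measureU2 _ _ _) _.
  - apply: measurableI => //; rewrite -[X in measurable X]setTI.
    by apply: measurable_lte => //; exact: measurable_Th.
  - exact: measurableI.
  - rewrite -[leRHS]adde0; apply: leeD; rewrite le_eqVlt; apply/orP; left; apply/eqP.
      exact: sojourn_lt0_null.
    exact: E.
apply: subset_measure0 Z.
- apply: measurableI => //; rewrite -[X in measurable X]setTI.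
  by apply: measurable_lee => //; exact: measurable_Th.
- apply: measurableU; apply: measurableI => //; rewrite -[X in measurable X]setTI.
  by apply: measurable_lte => //; exact: measurable_Th.
- move=> w [aw /= le]; have [lt|ge] := ltP (Th n.+1 w) 0%E; first by left.
  have T0 : Th n.+1 w = 0%E by apply/le_anti; rewrite le ge.
  by right; split=> /=; [rewrite T0|apply/aliveS; split=> //; rewrite T0].
Qed.

Lemma sojourn_gt0_ae : {ae P, forall w, forall n, alive n w -> (0 < Th n.+1 w)%E}.
Proof.
have N n : P.-negligible (alive n `&` [set w | Th n.+1 w <= 0]%E).
  apply/negligibleP; last exact: sojourn_le0_null.
  apply: measurableI; first exact: measurable_alive.
  rewrite -[X in measurable X]setTI.
  by apply: measurable_lee => //; exact: measurable_Th.
apply: negligibleS (negligible_bigcup N).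
move=> w /= /existsNP[n /not_implyP[an /negP]]; rewrite -leNgt => le.
by exists n.
Qed.

Section cost.
Variable f : Sm -> Am -> \bar R.
Hypothesis mf : measurable_fun setT (fun xa : Sm * Am => f xa.1 xa.2).
Hypothesis f0 : forall x a, (0 <= f x a)%E.

Lemma measurable_rate : measurable_fun setT (fun wt : Om * R => rate p f wt.1 wt.2).
Proof.
apply: ge0_emeasurable_sum.
  move=> n z _ _; apply: nneseries_ge0 => m _ _.
  by case: ifP => // _; apply: integral_ge0.
move=> n _; apply: ge0_emeasurable_sum.
  by move=> m z _ _; case: ifP => // _; apply: integral_ge0.
move=> m _; have mT k : measurable_fun setT (fun wt : Om * R => Tj k wt.1).
  by apply: measurableT_comp => //; exact: measurable_Tj.
have mt : measurable_fun setT (fun wt : Om * R => wt.2%:E) by exact/measurable_EFinP.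
apply: measurable_fun_ifT => //.
  by apply: measurable_and; apply: measurable_and;
    [exact: measurable_fun_lee|exact: measurable_fun_lte|
     exact: measurable_fun_lte|exact: measurable_fun_lee].
apply: (@measurable_fun_integral_prob _ _ (Om * R)%type Am R
  (fun z => p m z.1 (z.2 - fine (Tj m z.1))) _ _ (fun z => f (X n z.1.1) z.2)) => //.
- move=> U mU; apply: (@measurable_fun_uncurried _ _ _ _ _ _ _ _
    (fun w s => p m w s U)) => //; first exact: mp.
  by apply: measurable_funB => //; exact: measurableT_comp.
- apply: measurable_fun_uncurried => //.
  exact: (measurableT_comp (measurable_X n) (measurableT_comp measurable_fst measurable_fst)).
Qed.

(** Almost every path has positive sojourns, so [path_cost] cuts its time integral at the jumps;
    [survival_integral] then replaces the random end of each sojourn by the weight [surv]. *)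
Lemma expcost_sojourns : expcost P p f = (\sum_(n <oo) \int[P]_(w in alive n)
  \int[leb]_(s in `[0%R, +oo[) ((surv n w s)%:E * actint f n w s))%E.
Proof.
pose J n w := (\int[leb]_(s in `[0%R, +oo[)
  (if s%:E <= Th n.+1 w then actint f n w s else 0))%E.
have J0 n w : (0 <= J n w)%E.
  by apply: integral_ge0 => s _; case: ifP => // _; exact: actint_ge0.
have mJ n : measurable_fun setT (J n).
  rewrite /J; apply: (measurable_fun_fubini_in leb (f := fun z : Om * R =>
    if (z.2%:E <= Th n.+1 z.1)%E then actint f n z.1 z.2 else 0%E)) => //.
    apply: measurable_fun_ifT => //; last exact: measurable_actint.
    apply: measurable_fun_lee; first exact/measurable_EFinP.
    by apply: measurableT_comp => //; exact: measurable_Th.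
  by move=> z; case: ifP => // _; exact: actint_ge0.
have mt n : measurable_fun setT (fun w : Om => ((\1_(alive n) w)%:E * J n w)%E).
  apply: emeasurable_funM => //; apply/measurable_EFinP/measurable_indic.
  exact: measurable_alive.
have t0 n w : (0 <= (\1_(alive n) w)%:E * J n w)%E by rewrite mule_ge0// lee_fin.
transitivity (\int[P]_w \sum_(n <oo) ((\1_(alive n) w)%:E * J n w))%E.
  apply: ge0_ae_eq_integral => //.
  - apply: (measurable_fun_fubini_in leb (f := fun z : Om * R => rate p f z.1 z.2)) => //.
      exact: measurable_rate.
    move=> z; apply: nneseries_ge0 => n _ _; apply: nneseries_ge0 => m _ _.
    by case: ifP => // _; apply: integral_ge0.
  - by apply: ge0_emeasurable_sum.
  - move=> w _; apply: integral_ge0 => t _.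
    apply: nneseries_ge0 => n _ _; apply: nneseries_ge0 => m _ _.
    by case: ifP => // _; apply: integral_ge0.
  - by move=> w _; apply: nneseries_ge0.
  - move: sojourn_gt0_ae; apply: filterS => w gw _; apply: path_cost => //.
    exact: (measurableT_comp measurable_rate (pair1_measurable w)).
rewrite integral_nneseries//; apply: eq_eseriesr => n _.
transitivity (\int[P]_(w in alive n) J n w)%E.
  rewrite [RHS]integral_mkcond; apply: eq_integral => w _; rewrite patchE indicE.
  by case: ifP => _; rewrite ?mul1e ?mul0e.
apply: (@survival_integral n (fun z => actint f n z.1 z.2)).
- exact: measurable_actint.
- by move=> z; exact: actint_ge0.
- by move=> w s /=; exact: actint_trunc.
Qed.

End cost.

(** Makes [expcost] an integral in its cost function, so that linearity and monotonicity come for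
    free. Each sojourn contributes the mixture, over [P \x leb] weighted by [surv], of the action
    laws placed at the current state. *)
Lemma occupation_measure_exists : exists eta : {measure set (Sm * Am) -> \bar R},
  forall f, measurable_fun setT (fun xa : Sm * Am => f xa.1 xa.2) ->
    (forall x a, 0 <= f x a)%E ->
    expcost P p f = (\int[eta]_z f z.1 z.2)%E.
Proof.
have mX (x : Sm) : measurable_fun setT (fun a : Am => (x, a)) by exact: pair1_measurable.
pose k n (ws : Om * R) : {measure set (Sm * Am) -> \bar R} :=
  measure_function_pushforward__canonical__measure_function_Measure
    (p n ws.1 ws.2) (mX (X n ws.1)).
have mk n U : measurable U -> measurable_fun setT (fun ws => k n ws U).
  move=> mU; pose f x a : \bar R := (\1_U (x, a))%:E.
  apply: (eq_measurable_fun (fun ws : Om * R => actint f n ws.1 ws.2)); last first.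
    apply: measurable_actint => //; last by move=> x a; rewrite lee_fin.
    apply/measurable_EFinP; rewrite (_ : (fun _ => _) = \1_U); first exact: measurable_indic.
    by apply/funext => -[].
  move=> ws _; rewrite /actint /f.
  transitivity (\int[p n ws.1 ws.2]_a (\1_((fun a => (X n ws.1, a)) @^-1` U) a)%:E)%E.
    by apply: eq_integral => a _; rewrite !indicE.
  rewrite integral_indic ?setIT//.
  by rewrite -[X in measurable X]setTI; apply: (mX (X n ws.1)).
pose g n (ws : Om * R) : R :=
  \1_(alive n) ws.1 * \1_(`[0, +oo[%classic) ws.2 * surv n ws.1 ws.2.
have mg n : measurable_fun setT (g n).
  apply: measurable_funM => //; apply: measurable_funM => //.
    by apply: measurableT_comp => //; apply: measurable_indic; exact: measurable_alive.
  by apply: measurableT_comp => //; exact: measurable_indic.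
have g0 n ws : 0 <= g n ws by rewrite !mulr_ge0// expR_ge0.
have [m mI] := choice (fun n => weighted_mixture (P \x leb)%E (mk n) (mg n) (g0 n)).
exists (mseries m 0) => f mf f0.
have f0' (z : Sm * Am) : (0 <= f z.1 z.2)%E by [].
rewrite ge0_integral_measure_series// expcost_sojourns//.
apply: eq_eseriesr => n _; rewrite (mI n).2//.
have kI ws : (\int[k n ws]_z f z.1 z.2)%E = actint f n ws.1 ws.2.
  by rewrite /k/= ge0_integral_pushforward.
have mgk : measurable_fun setT (fun z : Om * R => ((g n z)%:E * \int[k n z]_y f y.1 y.2)%E).
  apply: emeasurable_funM; first exact/measurable_EFinP.
  apply: (eq_measurable_fun (fun ws : Om * R => actint f n ws.1 ws.2)) => [ws _|].
    by rewrite kI.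
  exact: measurable_actint.
rewrite (@fubini_tonelli1 _ _ _ _ R P leb
  (fun z => (g n z)%:E * \int[k n z]_y f y.1 y.2)%E); last 2 first.
- exact: mgk.
- by move=> z; rewrite kI mule_ge0 ?lee_fin// actint_ge0.
rewrite [LHS]integral_mkcond; apply: eq_integral => w _; rewrite patchE /fubini_F.
case: ifPn => wA; last first.
  by rewrite integral0_eq// => s _; rewrite /g/= indicE (negbTE wA) !mul0r mul0e.
rewrite [LHS]integral_mkcond; apply: eq_integral => s _; rewrite patchE kI /g/=.
by rewrite !indicE wA mul1r; case: ifPn => _; rewrite ?mul1r// mul0r mul0e.
Qed.

Lemma marginal_measure_exists (D : set Sm) : measurable D ->
  exists m : nat -> {measure set Sm -> \bar R}, forall n,
  (forall G, measurable G -> m n G = P (alive n `&` X n @^-1` (G `&` D))) /\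
  (forall h, measurable_fun setT h -> (forall x, 0 <= h x)%E ->
     (\int[m n]_x h x = \int[P]_(w in alive n `&` X n @^-1` D) h (X n w))%E).
Proof.
move=> mD.
have mXD n (G : set Sm) : measurable G -> measurable (@X R S n @^-1` G).
  by move=> mG; rewrite -[X in measurable X]setTI; exact: measurable_X.
have mE n (G : set Sm) : measurable G -> measurable (alive n `&` @X R S n @^-1` G).
  by move=> mG; apply: measurableI; [exact: measurable_alive|exact: mXD].
pose g n (w : Om) : R := \1_(alive n `&` X n @^-1` D) w.
have mg n : measurable_fun setT (g n) by apply: measurable_indic; exact: mE.
have g0 n w : 0 <= g n w by [].
have [m mP] := choice (fun n => weighted_mixture P
  (fun U mU => measurable_fun_dirac_at (@measurable_X R S n) mU) (mg n) (g0 n)).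
exists m => n; have [mE' mI] := mP n; split=> [G mG|h mh h0].
  rewrite mE'// -[X in P X]setIT -integral_indic//; last by apply: mE; exact: measurableI.
  apply: eq_integral => w _.
  transitivity ((g n w)%:E * ((X n w \in G)%:R)%:E)%E; first by [].
  rewrite -EFinM /g !indicE -natrM mulnb; congr ((nat_of_bool _)%:R%:E).
  by rewrite preimage_setI !in_setI -andbA [X in _ && X]andbC.
rewrite mI// [RHS]integral_mkcond; apply: eq_integral => w _.
rewrite patchE integral_dirac// diracT mul1e /g indicE.
by case: ifP => _; rewrite ?mul1e ?mul0e.
Qed.

Lemma integral_X0 h : measurable_fun setT h -> (forall x, 0 <= h x)%E ->
  (\int[P]_w h (X 0 w) = \int[gam]_x h x)%E.
Proof.
move=> mh h0; have mX0 := @measurable_X R S 0.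
transitivity (\int[pushforward P (@X R S 0)]_x h x)%E.
  by rewrite ge0_integral_pushforward.
apply: eq_measure_integral => G mG _.
by case: hP => H _ _; rewrite -H.
Qed.

Lemma sojourn_total_le1 n w :
  (\int[leb]_(s in `[0%R, +oo[) (lam n w s * surv n w s)%:E <= 1)%E.
Proof. by have [M lM] := lam_bd n w; exact: (hazard_le1 (measurable_lam1 n w) _ lM). Qed.

(* If the cost of a sojourn is finite and cost plus exit rate stay away from [0],
   the integrated exit rate is infinite, so the sojourn ends. *)
Lemma sojourn_total_eq1 n w f (e : R) :
  measurable_fun setT (fun xa : Sm * Am => f xa.1 xa.2) ->
  (forall x a, (0 <= f x a)%E) ->
  0 < e -> (forall a, (e%:E <= (qx (X n w) a)%:E + f (X n w) a)%E) ->
  (\int[leb]_(s in `[0%R, +oo[) ((surv n w s)%:E * actint f n w s) < +oo)%E ->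
  (\int[leb]_(s in `[0%R, +oo[) (lam n w s * surv n w s)%:E = 1)%E.
Proof.
move=> mf f0 e0 ef fin; have [M lM] := lam_bd n w.
apply: (hazard_eq1 (measurable_lam1 n w) _ lM) => //.
apply: contrapT => nL.
have [B LB] : exists B, forall t, 0 <= t -> \int[leb]_(s in `[0, t]) lam n w s <= B.
  apply: contrapT => nB; apply: nL => B; apply: contrapT => nt; apply: nB; exists B.
  by move=> t t0; rewrite leNgt; apply/negP => lt; apply: nt; exists t => //; exact: ltW.
have ms : measurable_fun setT (surv n w).
  exact: (measurableT_comp (measurable_surv n) (pair1_measurable w)).
have ma : measurable_fun setT (actint f n w).
  exact: (measurableT_comp (measurable_actint hp mf f0 n) (pair1_measurable w)).
have a0 s : (0 <= actint f n w s)%E by exact: actint_ge0.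
have msl : measurable_fun setT (fun s => (lam n w s * surv n w s)%:E).
  by apply/measurable_EFinP; exact: measurable_funM.
have msa : measurable_fun setT (fun s => ((surv n w s)%:E * actint f n w s)%E).
  by apply: emeasurable_funM => //; exact/measurable_EFinP.
have : (\int[leb]_(s in `[0%R, +oo[) ((lam n w s * surv n w s)%:E +
    (surv n w s)%:E * actint f n w s) < +oo)%E.
  rewrite ge0_integralD//; last 4 first.
  - by move=> s _; rewrite lee_fin mulr_ge0// expR_ge0.
  - exact: measurable_funTS.
  - by move=> s _; rewrite mule_ge0// lee_fin expR_ge0.
  - exact: measurable_funTS.
  by rewrite lte_add_pinfty// (le_lt_trans (sojourn_total_le1 n w))// ltry.
apply/negP; rewrite -leNgt.
(* If the integrated rate stays below [B], then [surv] is at least [expR (- B)] while rate plus cost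
   is at least [e]: a positive constant integrated over a half-line. *)
have -> : +oo%E = (\int[leb]_(s in `[0%R, +oo[) (cst (expR (- B) * e)%:E s))%E.
  rewrite integral_cst//=; have -> : leb `[0%R, +oo[%classic = +oo%E.
    by rewrite lebesgue_measure_itv/= ltry.
  rewrite gt0_muley// lte_fin mulr_gt0//.
  exact: expR_gt0.
apply: ge0_le_integral => //.
- by move=> s _; rewrite lee_fin mulr_ge0 ?expR_ge0// ltW.
- by apply: emeasurable_funD; exact: measurable_funTS.
- move=> s /=; rewrite in_itv/= andbT => s0.
  have sB : expR (- B) <= surv n w s by rewrite ler_expR lerN2 LB.
  have ea : (e%:E <= (lam n w s)%:E + actint f n w s)%E.
    rewrite -lamE -ge0_integralD//; last 2 first.
    - exact: (measurableT_comp mqE (pair1_measurable (X n w))).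
    - exact: (measurableT_comp mf (pair1_measurable (X n w))).
    apply: (@le_trans _ _ (\int[p n w s]_a (cst e%:E) a))%E.
      by rewrite integral_cst// p1 mule1.
    apply: ge0_le_integral => //.
    - by move=> a _; rewrite lee_fin ltW.
    - apply: emeasurable_funD.
        exact: (measurableT_comp mqE (pair1_measurable (X n w))).
      exact: (measurableT_comp mf (pair1_measurable (X n w))).
    - by move=> a _; exact: ef.
  have -> : ((lam n w s * surv n w s)%:E + (surv n w s)%:E * actint f n w s =
      (surv n w s)%:E * ((lam n w s)%:E + actint f n w s))%E.
    have lE : (0 <= (lam n w s)%:E)%E by rewrite lee_fin.
    by rewrite (ge0_muleDr _ lE (a0 s)) EFinM muleC.
  rewrite /cst EFinM; apply: lee_pmul => //; rewrite lee_fin ?expR_ge0//.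
  exact: ltW.
Qed.

End strategic_measure.

(** * Stationary policies *)

Lemma integral_null_measure d (T : measurableType d) (R : realType)
    (mu : {measure set T -> \bar R}) (h : T -> \bar R) :
  mu setT = 0%E -> (\int[mu]_x h x = 0)%E.
Proof.
move=> mu0; rewrite -[RHS](integral_measure_zero setT h).
apply: eq_measure_integral => B mB _.
by apply/eqP; rewrite -measure_le0 -mu0; apply: le_measure; rewrite ?inE.
Qed.

Section stationary_policy.
Context (R : realType) (S A : ptopologicalType).
Local Notation Sm := (borel S).
Local Notation Am := (borel A).
Local Notation Om := (Omega R S).
Local Notation leb := (@lebesgue_measure R).
Variables (qt : Sm -> Am -> {measure set Sm -> \bar R}) (qx : S -> A -> R).
Hypothesis mqt : forall G : set Sm, measurable G ->
  measurable_fun setT (fun xa : Sm * Am => qt xa.1 xa.2 G).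
Hypothesis mqx : measurable_fun setT (fun xa : Sm * Am => qx xa.1 xa.2).
Hypothesis qx0 : forall x a, 0 <= qx x a.
Hypothesis qxbd : forall x, exists M : R, forall a, qx x a <= M.
Hypothesis qtT : forall x a, qt x a setT = (qx x a)%:E.
Variable phi : Sm -> {measure set Am -> \bar R}.
Hypothesis hphi : stoch_kernel phi.

Let phi1 x : phi x setT = 1%E. Proof. by case: hphi. Qed.
Let mphi U : measurable U -> measurable_fun setT (fun x => phi x U).
Proof. by case: hphi => _; apply. Qed.

Lemma is_policy_stationary : is_policy (@stationary R S A phi).
Proof.
split=> [n w s|n w w' s w0 ww U|n U mU].
- exact: phi1.
- rewrite /stationary; congr (phi _ U).
  by case: n ww => // n ww; rewrite /X ww// ltnSn.
- exact: (measurableT_comp (mphi mU) (measurableT_comp (measurable_X n) measurable_fst)).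
Qed.

Definition avg (f : Sm -> Am -> \bar R) x : \bar R := (\int[phi x]_a f x a)%E.

Lemma avg_ge0 f x : (forall x a, 0 <= f x a)%E -> (0 <= avg f x)%E.
Proof. by move=> f0; apply: integral_ge0 => a _. Qed.

Lemma measurable_avg f :
  measurable_fun setT (fun xa : Sm * Am => f xa.1 xa.2) ->
  (forall x a, 0 <= f x a)%E -> measurable_fun setT (avg f).
Proof.
move=> mf f0.
exact: (@measurable_fun_integral_prob _ _ Sm Am R phi phi1 mphi (fun z => f z.1 z.2)).
Qed.

Let qE : Sm -> Am -> \bar R := fun x a => (qx x a)%:E.
Let mqE : measurable_fun setT (fun xa : Sm * Am => qE xa.1 xa.2).
Proof. exact/measurable_EFinP. Qed.
Let qE0 x a : (0 <= qE x a)%E. Proof. by rewrite lee_fin. Qed.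

Definition exit_rate x : R := fine (avg qE x).

Lemma exit_rateE x : avg qE x = (exit_rate x)%:E.
Proof.
rewrite /exit_rate fineK// ge0_fin_numE ?avg_ge0//; have [M qM] := qxbd x.
apply: (@le_lt_trans _ _ (\int[phi x]_a (cst M%:E) a))%E.
  apply: ge0_le_integral => //.
    exact: (measurableT_comp mqE (pair1_measurable x)).
  by move=> a _; rewrite lee_fin.
by rewrite integral_cst// phi1 mule1 ltry.
Qed.

Lemma exit_rate_ge0 x : 0 <= exit_rate x.
Proof. by rewrite -lee_fin -exit_rateE avg_ge0. Qed.

(** The mean sojourn time in x: the inverse of the exit rate, or [+oo] when that rate is 0. It is
    kept as an integral so that both cases are treated together. *)
Definition holding x : \bar R :=
  (\int[leb]_(s in `[0%R, +oo[) (expR (- \int[leb]_(u in `[0, s]) exit_rate x))%:E)%E.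

Lemma holding_ge0 x : (0 <= holding x)%E.
Proof. by apply: integral_ge0 => s _; rewrite lee_fin expR_ge0. Qed.

Let mexit : measurable_fun setT exit_rate.
Proof. by apply: measurableT_comp => //; exact: measurable_avg. Qed.

Let msurv : measurable_fun setT
  (fun z : Sm * R => (expR (- \int[leb]_(u in `[0, z.2]) exit_rate z.1))%:E).
Proof.
apply/measurable_EFinP; do 3 apply: measurableT_comp => //.
apply: (@measurable_fun_cumulative _ Sm R (fun z => (exit_rate z.1)%:E)).
  by apply/measurable_EFinP; exact: measurableT_comp.
by move=> z; rewrite lee_fin exit_rate_ge0.
Qed.

Let msurv1 x : measurable_fun setT
  (fun s : R => (expR (- \int[leb]_(u in `[0, s]) exit_rate x))%:E).
Proof. exact: (measurableT_comp msurv (pair1_measurable x)). Qed.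

Lemma measurable_holding : measurable_fun setT holding.
Proof.
apply: (measurable_fun_fubini_in leb (f := fun z : Sm * R =>
  (expR (- \int[leb]_(u in `[0, z.2]) exit_rate z.1))%:E)) => //.
Qed.

Lemma holding_gt0 x : (0 < holding x)%E.
Proof.
have l0 (s : R) : 0 <= exit_rate x by exact: exit_rate_ge0.
have ml : measurable_fun setT (fun _ : R => exit_rate x) by [].
apply: (@lt_le_trans _ _ (\int[leb]_(s in `[0%R, 1%R]) (cst (expR (- exit_rate x))%:E s))%E).
  rewrite integral_cst//= lebesgue_measure_itv/= lte_fin ltr01 sube0 mule1 lte_fin.
  exact: expR_gt0.
apply: (@le_trans _ _ (\int[leb]_(s in `[0%R, 1%R])
  (expR (- \int[leb]_(u in `[0, s]) exit_rate x))%:E)%E).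
  apply: ge0_le_integral => //.
  - by move=> s _; rewrite lee_fin expR_ge0.
  - by apply: measurable_funTS; exact: msurv1.
  - move=> s /=; rewrite in_itv/= => /andP[s0 s1]; rewrite lee_fin ler_expR lerN2.
    have /andP[_] := @hazard_le R (fun=> exit_rate x) (exit_rate x) ml l0
      (fun s => lexx _) 0 s (lexx _) s0.
    rewrite set_itv1 Rintegral_set1 !subr0 => /le_trans; apply.
    by rewrite -[leRHS]mulr1 ler_wpM2l// exit_rate_ge0.
apply: ge0_subset_integral => //.
- by apply: measurable_funTS; exact: msurv1.
- exact: subset_itvl.
Qed.

(** The product is the total mass of the density of the sojourn. A state that is never left gives
    0. *)
Lemma exit_rate_holding_le1 x : ((exit_rate x)%:E * holding x <= 1)%E.
Proof.
have l0 (s : R) : 0 <= exit_rate x by exact: exit_rate_ge0.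
have ml : measurable_fun setT (fun _ : R => exit_rate x) by [].
have := @hazard_le1 R (fun=> exit_rate x) (exit_rate x) ml l0 (fun s => lexx _).
apply: le_trans; rewrite /holding -ge0_integralZl//.
- by apply: measurable_funTS; exact: msurv1.
- by rewrite lee_fin exit_rate_ge0.
Qed.

Lemma holding_fin x : exit_rate x != 0 -> holding x \is a fin_num.
Proof.
move=> q0; rewrite ge0_fin_numE ?holding_ge0// ltNge leye_eq; apply/negP => /eqP E.
have := exit_rate_holding_le1 x; rewrite E gt0_muley ?leye_eq//.
by rewrite lte_fin lt_neqAle eq_sym q0 exit_rate_ge0.
Qed.

Section strategic.
Variables (gam : {measure set Sm -> \bar R}) (P : probability Om R).
Hypothesis hP : strategic qt qx gam (stationary phi) P.

Let sojournE f n w : measurable_fun setT (fun xa : Sm * Am => f xa.1 xa.2) ->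
  (forall x a, 0 <= f x a)%E ->
  (\int[leb]_(s in `[0%R, +oo[)
    ((surv qx (stationary phi) n w s)%:E * actint (stationary phi) f n w s) =
   holding (X n w) * avg f (X n w))%E.
Proof.
move=> mf f0; rewrite /holding -ge0_integralZr//.
- by apply: measurable_funTS; exact: msurv1.
- exact: avg_ge0.
Qed.

Lemma expcost_stationary f : measurable_fun setT (fun xa : Sm * Am => f xa.1 xa.2) ->
  (forall x a, 0 <= f x a)%E ->
  (expcost P (stationary phi) f =
   \sum_(n <oo) \int[P]_(w in alive n) (holding (X n w) * avg f (X n w)))%E.
Proof.
move=> mf f0.
rewrite (expcost_sojourns mqx qx0 qxbd is_policy_stationary hP mf f0).
apply: eq_eseriesr => n _; apply: eq_integral => w _; exact: sojournE.
Qed.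

Lemma jump_law_stationary n (G : set Sm) : measurable G ->
  (P (alive n.+1 `&` X n.+1 @^-1` G) =
   \int[P]_(w in alive n) (holding (X n w) * avg (fun x a => qt x a G) (X n w)))%E.
Proof.
move=> mG; rewrite (jump_law mqt mqx qx0 qxbd qtT is_policy_stationary hP)//.
by apply: eq_integral => w _; apply: sojournE => //; exact: mqt.
Qed.

End strategic.
End stationary_policy.

(** * The total cost of a deterministic stationary policy *)

Section deterministic_policy.
Context (R : realType) (S A : ptopologicalType).
Local Notation Sm := (borel S).
Local Notation Am := (borel A).
Local Notation Om := (Omega R S).
Variables (qt : Sm -> Am -> {measure set Sm -> \bar R}) (qx : S -> A -> R).
Hypothesis mqt : forall G : set Sm, measurable G ->
  measurable_fun setT (fun xa : Sm * Am => qt xa.1 xa.2 G).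
Hypothesis mqx : measurable_fun setT (fun xa : Sm * Am => qx xa.1 xa.2).
Hypothesis qx0 : forall x a, 0 <= qx x a.
Hypothesis qxbd : forall x, exists M : R, forall a, qx x a <= M.
Hypothesis qtT : forall x a, qt x a setT = (qx x a)%:E.
Variable psi : Sm -> Am.
Hypothesis mpsi : measurable_fun setT psi.
Variable c : Sm -> Am -> \bar R.
Hypothesis mc : measurable_fun setT (fun xa : Sm * Am => c xa.1 xa.2).
Hypothesis c0 : forall x a, (0 <= c x a)%E.

Definition dirac_kernel (x : Sm) : {measure set Am -> \bar R} := \d_(psi x).

Lemma stoch_kernel_dirac : stoch_kernel dirac_kernel.
Proof.
by split=> [x|U mU]; [exact: diracT|exact: measurable_fun_dirac_at].
Qed.

Lemma det_markov_det_stationary : det_markov (@det_stationary R S A psi).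
Proof.
split; first exact: (is_policy_stationary stoch_kernel_dirac).
by move=> n; exists (fun x _ => psi x).
Qed.

Lemma avg_dirac f x : measurable_fun setT (fun xa : Sm * Am => f xa.1 xa.2) ->
  avg dirac_kernel f x = f x (psi x).
Proof.
move=> mf; rewrite /avg integral_dirac//; last first.
  exact: (measurableT_comp mf (pair1_measurable x)).
by rewrite diracT mul1e.
Qed.

Local Notation hold := (holding qx dirac_kernel).

Definition jumpop (h : Sm -> \bar R) (x : Sm) : \bar R :=
  (hold x * \int[qt x (psi x)]_y h y)%E.

Definition sojourn_cost (x : Sm) : \bar R := (hold x * c x (psi x))%E.

(** Strategic measures are given one initial law at a time, with nothing said about their dependence
    on it. This series only iterates a measurable kernel, so it is visibly measurable in x;
    [expcost_det_stationary] identifies it with the expected cost. *)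
Definition total_cost (x : Sm) : \bar R :=
  (\sum_(n <oo) iter n jumpop sojourn_cost x)%E.

Let hold0 x : (0 <= hold x)%E. Proof. exact: holding_ge0. Qed.
Let mhold : measurable_fun setT hold.
Proof. exact: (measurable_holding mqx qx0 qxbd stoch_kernel_dirac). Qed.

Let mqtpsi U : measurable U -> measurable_fun setT (fun x => qt x (psi x) U).
Proof.
move=> mU; apply: (@measurable_fun_uncurried _ _ _ _ _ _ _ _ (fun x a => qt x a U)) => //.
exact: mqt.
Qed.

Let jump_ge0 h : (forall x, 0 <= h x)%E -> forall x, (0 <= jumpop h x)%E.
Proof. by move=> h0 x; rewrite mule_ge0// integral_ge0. Qed.

Let measurable_jump h : (forall x, 0 <= h x)%E -> measurable_fun setT h ->
  measurable_fun setT (jumpop h).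
Proof.
move=> h0 mh; apply: emeasurable_funM => //.
exact: measurable_fun_integral_kernel.
Qed.

Let sc0 x : (0 <= sojourn_cost x)%E. Proof. by rewrite mule_ge0. Qed.

Let iter_ge0 n x : (0 <= iter n jumpop sojourn_cost x)%E.
Proof. by elim: n x => [|n ih] x //=; exact: jump_ge0. Qed.

Let measurable_iter n : measurable_fun setT (iter n jumpop sojourn_cost).
Proof.
elim: n => [|n ih] /=; last exact: measurable_jump.
by apply: emeasurable_funM => //; exact: measurable_fun_uncurried.
Qed.

Lemma total_cost_ge0 x : (0 <= total_cost x)%E.
Proof. by apply: nneseries_ge0. Qed.

Lemma measurable_total_cost : measurable_fun setT total_cost.
Proof. by apply: ge0_emeasurable_sum. Qed.

Let qtpsi0 x (h : Sm -> \bar R) : exit_rate qx dirac_kernel x = 0 ->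
  (\int[qt x (psi x)]_y h y = 0)%E.
Proof.
move=> q0; apply: integral_null_measure; rewrite qtT.
have := exit_rateE mqx qx0 qxbd stoch_kernel_dirac x.
by rewrite avg_dirac ?q0//; exact/measurable_EFinP.
Qed.

(** An infinite mean sojourn forces exit rate 0, so the jump measure is null and both sides vanish.
    This supplies the real weight that [mixture_eq] demands in [jump_step]. *)
Lemma hold_fineE x (h : Sm -> \bar R) :
  (hold x * \int[qt x (psi x)]_y h y = (fine (hold x))%:E * \int[qt x (psi x)]_y h y)%E.
Proof.
have [q0|q0] := eqVneq (exit_rate qx dirac_kernel x) 0.
  by rewrite qtpsi0// !mule0.
by rewrite fineK//; exact: (holding_fin mqx qx0 qxbd stoch_kernel_dirac).
Qed.

Section strategic.
Variables (x0 : Sm) (P : probability Om R).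
Hypothesis hP : strategic qt qx (\d_x0) (det_stationary psi) P.

Let jump_step n h : (forall x, 0 <= h x)%E -> measurable_fun setT h ->
  (\int[P]_(w in alive n.+1) h (X n.+1 w) = \int[P]_(w in alive n) jumpop h (X n w))%E.
Proof.
move=> h0 mh.
have mA := @measurable_alive R S n; have mA1 := @measurable_alive R S n.+1.
pose g1 (w : Om) : R := \1_(alive n.+1) w.
pose g2 (w : Om) : R := \1_(alive n) w * fine (hold (X n w)).
have mg1 : measurable_fun setT g1 by exact: measurable_indic.
have mg2 : measurable_fun setT g2.
  apply: measurable_funM; first exact: measurable_indic.
  apply: (measurableT_comp (f := fine)); first exact: fine_measurable.
  exact: (measurableT_comp mhold (@measurable_X R S n)).
have g10 w : 0 <= g1 w by [].
have g20 w : 0 <= g2 w by rewrite mulr_ge0// fine_ge0.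
have mk2 (U : set Sm) : measurable U ->
    measurable_fun setT (fun w : Om => qt (X n w) (psi (X n w)) U).
  by move=> mU; exact: (measurableT_comp (mqtpsi mU) (@measurable_X R S n)).
have H := fun E => @mixture_eq _ _ _ Om Om Sm R P P (fun w => \d_(X n.+1 w))
  (fun w => qt (X n w) (psi (X n w))) g1 g2 h
  (fun U mU => measurable_fun_dirac_at (@measurable_X R S n.+1) mU) mk2
  mg1 mg2 g10 g20 E mh h0.
have R2 (k : Om -> \bar R) : (\int[P]_w ((g2 w)%:E * k w) =
    \int[P]_(w in alive n) ((fine (hold (X n w)))%:E * k w))%E.
  rewrite [RHS]integral_mkcond; apply: eq_integral => w _; rewrite patchE /g2 indicE.
  by case: ifP => _; rewrite ?mul1r// mul0r mul0e.
transitivity (\int[P]_w ((g1 w)%:E * \int[\d_(X n.+1 w)]_z h z))%E.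
  rewrite [LHS]integral_mkcond; apply: eq_integral => w _.
  rewrite patchE integral_dirac// diracT mul1e /g1 indicE.
  by case: ifP => _; rewrite ?mul1e ?mul0e.
rewrite H ?R2; first by apply: eq_integral => w _; rewrite /jumpop hold_fineE.
move=> U mU; rewrite R2.
have mXU : measurable (@X R S n.+1 @^-1` U).
  by rewrite -[X in measurable X]setTI; exact: measurable_X.
transitivity (P (alive n.+1 `&` X n.+1 @^-1` U)).
  rewrite -[X in P X]setIT -integral_indic//; last exact: measurableI.
  apply: eq_integral => w _.
  transitivity ((g1 w)%:E * ((X n.+1 w \in U)%:R)%:E)%E; first by [].
  by rewrite -EFinM /g1 !indicE -natrM mulnb in_setI.
rewrite (jump_law_stationary mqt mqx qx0 qxbd qtT stoch_kernel_dirac hP)//.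
apply: eq_integral => w _; rewrite avg_dirac; last exact: mqt.
have := hold_fineE (X n w) (fun y => (\1_U y)%:E).
by rewrite integral_indic// setIT.
Qed.

Let marginal n h : (forall x, 0 <= h x)%E -> measurable_fun setT h ->
  (\int[P]_(w in alive n) h (X n w) = iter n jumpop h x0)%E.
Proof.
elim: n h => [|n ih] h h0 mh.
  by rewrite alive0 (integral_X0 hP mh h0) integral_dirac// diracT mul1e.
rewrite jump_step// ih ?iterSr//; first exact: jump_ge0.
exact: measurable_jump.
Qed.

Lemma expcost_det_stationary : expcost P (det_stationary psi) c = total_cost x0.
Proof.
rewrite (expcost_stationary mqx qx0 qxbd stoch_kernel_dirac hP mc c0).
apply: eq_eseriesr => n _; rewrite -marginal//; last first.
  by apply: emeasurable_funM => //; exact: measurable_fun_uncurried.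
by apply: eq_integral => w _; rewrite avg_dirac.
Qed.

End strategic.

Let iter_eq0 n x : total_cost x = 0%E -> iter n jumpop sojourn_cost x = 0%E.
Proof.
move=> V0; apply/le_anti/andP; split; last exact: iter_ge0.
rewrite -V0 /total_cost (@nneseriesD1 _ _ n xpredT)//.
by rewrite leeDl// nneseries_ge0.
Qed.

Let hold_mul_eq0 x y : (hold x * y = 0)%E -> y = 0%E.
Proof.
move/eqP; rewrite mule_eq0 => /orP[/eqP h0|/eqP//].
have := holding_gt0 mqx qx0 qxbd stoch_kernel_dirac x.
by rewrite h0 ltxx.
Qed.

Lemma total_cost0_cost x : total_cost x = 0%E -> c x (psi x) = 0%E.
Proof. by move/(iter_eq0 0)/hold_mul_eq0. Qed.

(** Every iterate vanishes at x, and mean sojourns are positive; so each iterate has integral 0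
    under the jump measure at x, hence so does the total cost, which must vanish almost everywhere
    there. *)
Lemma total_cost0_closed x : total_cost x = 0%E ->
  qt x (psi x) [set y | total_cost y <> 0%E] = 0%E.
Proof.
move=> V0.
have I0 : (\int[qt x (psi x)]_y total_cost y = 0)%E.
  rewrite integral_nneseries//.
  by apply: eseries0 => n _ _; apply: (@hold_mul_eq0 x); exact: (iter_eq0 n.+1 V0).
have mV := measurable_total_cost.
have : ae_eq (qt x (psi x)) setT total_cost (cst 0%E).
  apply/(ae_eq_integral_abs _ measurableT mV).
  by rewrite -[RHS]I0; apply: eq_integral => y _; rewrite gee0_abs// total_cost_ge0.
have mN : measurable [set y | total_cost y <> 0%E].
  rewrite (_ : [set _ | _] = setT `&` [set y | total_cost y != 0%E]).
    exact: measurable_neqe.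
  by rewrite setTI; apply/seteqP; split=> y /= /eqP.
move=> H; apply/negligibleP => //; apply: negligibleS H => y /= V H.
by apply: V; exact: H.
Qed.

(** The sojourn is infinite, but its cost is 0 by the convention for the product of [+oo] and 0, and
    no jump follows. *)
Lemma total_cost_absorbing x : c x (psi x) = 0%E -> qx x (psi x) = 0 ->
  total_cost x = 0%E.
Proof.
move=> cx qx00; apply: eseries0 => -[|n] _ _ /=; first by rewrite /sojourn_cost cx mule0.
by rewrite /jumpop integral_null_measure ?mule0// qtT qx00.
Qed.

End deterministic_policy.

(** * Comparison of the policies *)

Section comparison.
Context (R : realType) (S A : ptopologicalType).
Local Notation Sm := (borel S).
Local Notation Am := (borel A).
Local Notation Om := (Omega R S).
Local Notation leb := (@lebesgue_measure R).
Variables (qt : Sm -> Am -> {measure set Sm -> \bar R}) (qx : S -> A -> R).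
Hypothesis mqt : forall G : set Sm, measurable G ->
  measurable_fun setT (fun xa : Sm * Am => qt xa.1 xa.2 G).
Hypothesis mqx : measurable_fun setT (fun xa : Sm * Am => qx xa.1 xa.2).
Hypothesis qx0 : forall x a, 0 <= qx x a.
Hypothesis qxbd : forall x, exists M : R, forall a, qx x a <= M.
Hypothesis qtT : forall x a, qt x a setT = (qx x a)%:E.
Variable gam : {measure set Sm -> \bar R}.
Variables (p : policy R S A) (P : probability Om R).
Hypothesis hp : is_policy p.
Hypothesis hP : strategic qt qx gam p P.
Variable phi : Sm -> {measure set Am -> \bar R}.
Hypothesis hphi : stoch_kernel phi.
Variable Pphi : probability Om R.
Hypothesis hPphi : strategic qt qx gam (stationary phi) Pphi.
Variables (c : Sm -> Am -> \bar R) (Z : set Sm).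
Hypothesis mc : measurable_fun setT (fun xa : Sm * Am => c xa.1 xa.2).
Hypothesis c0 : forall x a, (0 <= c x a)%E.
Hypothesis mZ : measurable Z.
Hypothesis cost_fin : (expcost P p c < +oo)%E.
Hypothesis Z_active : forall x, Z x ->
  exists2 e : R, 0 < e & forall a, (e%:E <= (qx x a)%:E + c x a)%E.
Hypothesis Z_exit : forall x, ~ Z x -> avg phi (fun x a => qt x a Z) x = 0%E.
Hypothesis hocc : forall G : set (Sm * Am), measurable G -> G `<=` Z `*` setT ->
  occ P p G = expcost P p (fun x _ => phi x (xsection G x)).

Let phi1 x : phi x setT = 1%E. Proof. by case: hphi. Qed.
Let mphi U : measurable U -> measurable_fun setT (fun x => phi x U).
Proof. by case: hphi => _; apply. Qed.

Let qE : Sm -> Am -> \bar R := fun x a => (qx x a)%:E.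
Let mqE : measurable_fun setT (fun xa : Sm * Am => qE xa.1 xa.2).
Proof. exact/measurable_EFinP. Qed.
Let qE0 x a : (0 <= qE x a)%E. Proof. by rewrite lee_fin. Qed.

Local Notation hold := (holding qx phi).
Let hold0 x : (0 <= hold x)%E. Proof. exact: holding_ge0. Qed.
Let mhold : measurable_fun setT hold.
Proof. exact: (measurable_holding mqx qx0 qxbd hphi). Qed.

Let on_Z (f : Sm -> Am -> \bar R) x a : \bar R := ((\1_Z x)%:E * f x a)%E.

Let on_Z_ge0 f : (forall x a, 0 <= f x a)%E -> forall x a, (0 <= on_Z f x a)%E.
Proof. by move=> f0 x a; rewrite mule_ge0// lee_fin. Qed.

Let measurable_on_Z f : measurable_fun setT (fun xa : Sm * Am => f xa.1 xa.2) ->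
  measurable_fun setT (fun xa : Sm * Am => on_Z f xa.1 xa.2).
Proof.
move=> mf; apply: emeasurable_funM => //; apply/measurable_EFinP.
by apply: measurableT_comp => //; exact: measurable_indic.
Qed.

Let mfst (g : Sm -> \bar R) : measurable_fun setT g ->
  measurable_fun setT (fun xa : Sm * Am => g xa.1).
Proof. by move=> mg; exact: (measurableT_comp mg measurable_fst). Qed.

Lemma expcost_le f g :
  measurable_fun setT (fun xa : Sm * Am => f xa.1 xa.2) ->
  measurable_fun setT (fun xa : Sm * Am => g xa.1 xa.2) ->
  (forall x a, 0 <= f x a)%E -> (forall x a, f x a <= g x a)%E ->
  (expcost P p f <= expcost P p g)%E.
Proof.
move=> mf mg f0 fg; have [eta E] := occupation_measure_exists mqx qx0 qxbd hp hP.
have g0 x a : (0 <= g x a)%E by exact: le_trans (f0 x a) (fg x a).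
by rewrite !E//; apply: ge0_le_integral.
Qed.

(** [hocc] is the same statement for indicators of sets inside [Z]. The cut-off [on_Z] is essential,
    since nothing links the occupation measure to [phi] outside [Z]. *)
Lemma expcost_disintegration f :
  measurable_fun setT (fun xa : Sm * Am => f xa.1 xa.2) ->
  (forall x a, 0 <= f x a)%E ->
  expcost P p (on_Z f) = expcost P p (on_Z (fun x _ => avg phi f x)).
Proof.
move=> mf f0; have [eta E] := occupation_measure_exists mqx qx0 qxbd hp hP.
have mX (x : Sm) : measurable_fun setT (fun a : Am => (x, a)) by exact: pair1_measurable.
pose k (z : Sm * Am) : {measure set (Sm * Am) -> \bar R} :=
  measure_function_pushforward__canonical__measure_function_Measure (phi z.1) (mX z.1).
have mk U : measurable U -> measurable_fun setT (fun z => k z U).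
  move=> mU; have H := @measurable_fun_xsection_prob _ _ Sm Am R phi phi1 mphi U mU.
  apply: (eq_measurable_fun (fun z : Sm * Am => phi z.1 (xsection U z.1))).
    by move=> z _; rewrite /k/= /pushforward xsectionE.
  exact: (measurableT_comp H measurable_fst).
(* [m] redraws the action from [phi] while keeping the state; by [hocc] it agrees with [eta] on the
   measurable subsets of [Z * A]. *)
have [m [mE mI]] := mixture eta mk.
have mg : measurable_fun setT (fun z : Sm * Am => on_Z f z.1 z.2).
  exact: measurable_on_Z.
have g0 (z : Sm * Am) : (0 <= on_Z f z.1 z.2)%E by exact: on_Z_ge0.
have mZT : measurable (Z `*` setT : set (Sm * Am)) by exact: measurableX.
have restr (nu : {measure set (Sm * Am) -> \bar R}) :
    (\int[nu]_z on_Z f z.1 z.2 = \int[nu]_(z in Z `*` setT) on_Z f z.1 z.2)%E.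
  rewrite [RHS]integral_mkcond; apply: eq_integral => z _; rewrite patchE.
  case: ifPn => //; rewrite notin_setE => nZ; rewrite /on_Z indicE memNset ?mul0e//.
  by move=> Zz; apply: nZ.
rewrite E//; last exact: on_Z_ge0.
rewrite restr (eq_measure_integral m); last first.
  move=> G mG GZ; have := hocc mG GZ; rewrite /occ.
  have mphiG : measurable_fun setT (fun x => phi x (xsection G x)).
    exact: (@measurable_fun_xsection_prob _ _ Sm Am R phi phi1 mphi G mG).
  rewrite E; last 2 first.
  - apply/measurable_EFinP; rewrite (_ : (fun _ => _) = \1_G); first exact: measurable_indic.
    by apply/funext => -[].
  - by move=> x a; rewrite lee_fin.
  rewrite E; last 2 first.
  - exact: (mfst mphiG).
  - by [].
  move=> H; transitivity (\int[eta]_z (\1_G z)%:E)%E.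
    by rewrite integral_indic ?setIT.
  transitivity (\int[eta]_z (\1_G (z.1, z.2))%:E)%E.
    by apply: eq_integral => -[].
  rewrite H mE//; apply: eq_integral => z _.
  by rewrite /k/= /pushforward xsectionE.
rewrite -restr mI// E; last 2 first.
- apply: measurable_on_Z; apply: mfst; exact: measurable_avg.
- by apply: on_Z_ge0 => x _; exact: avg_ge0.
apply: eq_integral => z _; rewrite /k/= ge0_integral_pushforward// preimage_setT /on_Z/=.
rewrite ge0_integralZl//.
exact: (measurableT_comp mf (pair1_measurable z.1)).
Qed.

Let sojourn_fin n : (\int[P]_(w in alive n) \int[leb]_(s in `[0%R, +oo[)
  ((surv qx p n w s)%:E * actint p c n w s) < +oo)%E.
Proof.
apply: le_lt_trans cost_fin.
rewrite (expcost_sojourns mqx qx0 qxbd hp hP mc c0) (@nneseriesD1 _ _ n xpredT)//.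
  rewrite leeDl// nneseries_ge0// => m _ _; apply: integral_ge0 => w _.
  by apply: integral_ge0 => s _; rewrite mule_ge0 ?lee_fin ?expR_ge0// actint_ge0.
move=> m _; apply: integral_ge0 => w _.
by apply: integral_ge0 => s _; rewrite mule_ge0 ?lee_fin ?expR_ge0// actint_ge0.
Qed.

(* Sojourns in [Z] are a.s. finite, so the rate-weighted occupation measure
   counts the visits to [Z]. *)
Lemma visits_eq_exits g : measurable_fun setT g -> (forall x, 0 <= g x)%E ->
  (\sum_(n <oo) \int[P]_(w in alive n `&` X n @^-1` Z) g (X n w) =
   expcost P p (on_Z (fun x a => g x * (qx x a)%:E)))%E.
Proof.
move=> mg g0.
pose f x a : \bar R := (g x * (qx x a)%:E)%E.
have mf : measurable_fun setT (fun xa : Sm * Am => f xa.1 xa.2).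
  by apply: emeasurable_funM => //; exact: mfst.
have f0 x a : (0 <= f x a)%E by rewrite mule_ge0// lee_fin.
rewrite (expcost_sojourns mqx qx0 qxbd hp hP (measurable_on_Z mf) (on_Z_ge0 f0)).
apply: eq_eseriesr => n _.
have mA := @measurable_alive R S n.
have mXn := @measurable_X R S n.
have mXZ : measurable (@X R S n @^-1` Z).
  by rewrite -[X in measurable X]setTI; exact: mXn.
have msl w : measurable_fun setT (fun s => (lam qx p n w s * surv qx p n w s)%:E).
  apply/measurable_EFinP; apply: measurable_funM; first exact: measurable_lam1.
  exact: (measurableT_comp (measurable_surv mqx qx0 qxbd hp n) (pair1_measurable w)).
have inner w : (\int[leb]_(s in `[0%R, +oo[) ((surv qx p n w s)%:E * actint p (on_Z f) n w s) =
    ((\1_Z (X n w))%:E * g (X n w)) *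
    \int[leb]_(s in `[0%R, +oo[) (lam qx p n w s * surv qx p n w s)%:E)%E.
  have k0 : (0 <= (\1_Z (X n w))%:E * g (X n w))%E by rewrite mule_ge0// lee_fin.
  rewrite -ge0_integralZl//; last 2 first.
  - by apply: measurable_funTS; exact: msl.
  - by move=> s _; rewrite lee_fin mulr_ge0 ?expR_ge0// lam_ge0.
  apply: eq_integral => s _.
  have -> : actint p (on_Z f) n w s =
      ((\1_Z (X n w))%:E * g (X n w) * (lam qx p n w s)%:E)%E.
    rewrite -(lamE mqx qx0 qxbd hp) /actint -ge0_integralZl//; last 2 first.
    - exact: (measurableT_comp mqE (pair1_measurable (X n w))).
    - by move=> a _; rewrite lee_fin.
    by apply: eq_integral => a _; rewrite /on_Z /f muleA.
  by rewrite muleCA -EFinM [X in (_ * X%:E)%E]mulrC.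
under [RHS]eq_integral do rewrite inner.
transitivity (\int[P]_(w in alive n) ((\1_Z (X n w))%:E * g (X n w)))%E.
  rewrite [LHS]integral_mkcondr; apply: eq_integral => w _; rewrite patchE indicE.
  have -> : (w \in X n @^-1` Z) = (X n w \in Z) by [].
  by case: ifP => _; rewrite ?mul1e ?mul0e.
have mgX : measurable_fun setT (fun w : Om => ((\1_Z (X n w))%:E * g (X n w))%E).
  apply: emeasurable_funM; last exact: (measurableT_comp mg mXn).
  exact: (measurable_fun_dirac_at mXn mZ).
pose I w := (\int[leb]_(s in `[0%R, +oo[) (lam qx p n w s * surv qx p n w s)%:E)%E.
have mlam : measurable_fun setT (fun ws : Om * R => lam qx p n ws.1 ws.2).
  exact: measurable_lam.
have mI : measurable_fun setT I.
  apply: (measurable_fun_fubini_in leb (f := fun z : Om * R =>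
    (lam qx p n z.1 z.2 * surv qx p n z.1 z.2)%:E)) => //.
  - apply/measurable_EFinP; apply: measurable_funM; first exact: mlam.
    exact: (measurable_surv mqx qx0 qxbd hp).
  - by move=> z; rewrite lee_fin mulr_ge0 ?expR_ge0// lam_ge0.
pose Jc w := (\int[leb]_(s in `[0%R, +oo[) ((surv qx p n w s)%:E * actint p c n w s))%E.
have mJ : measurable_fun setT Jc.
  apply: (measurable_fun_fubini_in leb (f := fun z : Om * R =>
    ((surv qx p n z.1 z.2)%:E * actint p c n z.1 z.2)%E)) => //.
  - apply: emeasurable_funM; last exact: measurable_actint.
    by apply/measurable_EFinP; exact: (measurable_surv mqx qx0 qxbd hp).
  - by move=> z; rewrite mule_ge0 ?lee_fin ?expR_ge0// actint_ge0.
have J0 w : (0 <= Jc w)%E.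
  by apply: integral_ge0 => s _; rewrite mule_ge0 ?lee_fin ?expR_ge0// actint_ge0.
(* Finite expected total cost makes the conditional cost of almost every sojourn finite, as
   [sojourn_total_eq1] requires. *)
have Jfin : {ae P, forall w, alive n w -> Jc w \is a fin_num}.
  apply: (@integrable_ae _ _ _ P (alive n) mA Jc).
  apply/integrableP; split; first exact: measurable_funTS.
  under eq_integral do rewrite gee0_abs//.
  exact: sojourn_fin.
apply: ge0_ae_eq_integral => //.
- exact: measurable_funTS.
- by apply: measurable_funTS; exact: emeasurable_funM.
- by move=> w _; rewrite mule_ge0// lee_fin.
- move=> w _; rewrite !mule_ge0// ?lee_fin//; apply: integral_ge0 => s _.
  by rewrite lee_fin mulr_ge0 ?expR_ge0// lam_ge0.
apply: filterS Jfin => w Jw aw; rewrite indicE.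
have [/set_mem XZ|_] := boolP (X n w \in Z); last by rewrite !mul0e.
have [e e0 ef] := Z_active XZ.
rewrite (sojourn_total_eq1 mqx qx0 qxbd hp mc c0 e0 ef) ?mule1//.
by move: (Jw aw); rewrite ge0_fin_numE.
Qed.

(** Visits become exits by [visits_eq_exits], the action is averaged under [phi], and there remains
    [hold * exit_rate <= 1]. Where [hold] is infinite the averaged exit rate is 0, so such states
    contribute nothing. *)
Lemma hold_visits_le g : measurable_fun setT g -> (forall x, 0 <= g x)%E ->
  (\sum_(n <oo) \int[P]_(w in alive n `&` X n @^-1` Z) (hold (X n w) * g (X n w)) <=
   expcost P p (on_Z (fun x _ => g x)))%E.
Proof.
move=> mg g0.
have hg0 x : (0 <= hold x * g x)%E by rewrite mule_ge0.
have mhg : measurable_fun setT (fun x => (hold x * g x)%E) by exact: emeasurable_funM.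
have E : (\sum_(n <oo) \int[P]_(w in alive n `&` X n @^-1` Z) (hold (X n w) * g (X n w)) =
    expcost P p (on_Z (fun x a => hold x * g x * (qx x a)%:E)))%E.
  exact: (@visits_eq_exits (fun x => (hold x * g x)%E) mhg hg0).
rewrite {}E.
have mf : measurable_fun setT (fun xa : Sm * Am => (hold xa.1 * g xa.1 * (qx xa.1 xa.2)%:E)%E).
  by apply: emeasurable_funM => //; exact: (mfst mhg).
have f0 x a : (0 <= hold x * g x * (qx x a)%:E)%E by rewrite mule_ge0// lee_fin.
rewrite (@expcost_disintegration (fun x a => hold x * g x * (qx x a)%:E)%E mf f0).
have aE x : (avg phi (fun x a => hold x * g x * (qx x a)%:E) x =
    hold x * g x * (exit_rate qx phi x)%:E)%E.
  rewrite -(exit_rateE mqx qx0 qxbd hphi) /avg ge0_integralZl//.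
  - exact: (measurableT_comp mqE (pair1_measurable x)).
  - by move=> a _; rewrite lee_fin.
apply: expcost_le.
- apply: measurable_on_Z; apply: mfst; exact: measurable_avg.
- by apply: measurable_on_Z; exact: mfst.
- by apply: on_Z_ge0 => x _; exact: avg_ge0.
- move=> x a; rewrite /on_Z lee_wpmul2l ?lee_fin// aE.
  rewrite muleAC [X in (X * _)%E]muleC -[leRHS]mul1e lee_wpmul2r//.
  exact: (exit_rate_holding_le1 mqx qx0 qxbd hphi).
Qed.

Lemma expcost_comparison f :
  measurable_fun setT (fun xa : Sm * Am => f xa.1 xa.2) ->
  (forall x a, 0 <= f x a)%E -> (forall x, ~ Z x -> avg phi f x = 0%E) ->
  (expcost Pphi (stationary phi) f <= expcost P p f)%E.
Proof.
move=> mf f0 fZ.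
have [mphi_ mphiP] := marginal_measure_exists Pphi mZ.
have [mpi mpiP] := marginal_measure_exists P mZ.
have mXG n (G : set Sm) : measurable G -> measurable (@X R S n @^-1` G).
  by move=> mG; rewrite -[X in measurable X]setTI; exact: measurable_X.
have restr n (h : Sm -> \bar R) : (forall x, ~ Z x -> h x = 0%E) ->
    (\int[Pphi]_(w in alive n) h (X n w) =
     \int[Pphi]_(w in alive n `&` X n @^-1` Z) h (X n w))%E.
  move=> hZ; rewrite [RHS]integral_mkcondr; apply: eq_integral => w _; rewrite patchE.
  case: ifPn => //; rewrite notin_setE => nZ; exact: hZ.
(* [Z] is not entered from outside, so only earlier visits to [Z] contribute to later ones. *)
have qtZ (G : set Sm) x : measurable G -> ~ Z x ->
    avg phi (fun x a => qt x a (G `&` Z)) x = 0%E.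
  move=> mG nZ; apply/le_anti/andP; split; last exact: avg_ge0.
  rewrite -(Z_exit nZ); apply: ge0_le_integral => //.
  - exact: (measurableT_comp (mqt (measurableI _ _ mG mZ)) (pair1_measurable x)).
  - exact: (measurableT_comp (mqt mZ) (pair1_measurable x)).
  - by move=> a _; apply: le_measure; rewrite ?inE//; exact: measurableI.
pose Mpi : {measure set Sm -> \bar R} := mseries mpi 0.
have Mpi_hold (g : Sm -> \bar R) : measurable_fun setT g -> (forall x, 0 <= g x)%E ->
    (\int[Mpi]_x (hold x * g x) <= expcost P p (on_Z (fun x _ => g x)))%E.
  move=> mg g0; have hg0 x : (0 <= hold x * g x)%E by rewrite mule_ge0.
  have mhg : measurable_fun setT (fun x => (hold x * g x)%E) by exact: emeasurable_funM.
  rewrite /Mpi ge0_integral_measure_series//; apply: le_trans (hold_visits_le mg g0).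
  by rewrite le_eqVlt; apply/orP; left; apply/eqP; apply: eq_eseriesr => n _;
    rewrite (mpiP n).2.
(* The induction is on partial sums bounded by the full series [Mpi]: visits before k + 1 are the
   initial law plus one jump from the visits before k, and only this shape accepts the inequality
   [Mpi_hold], which holds for the sum over n and not term by term. *)
have claim k (G : set Sm) : measurable G -> (msum mphi_ k G <= Mpi G)%E.
  elim: k G => [|k ih] G mG.
    by rewrite /msum big_ord0 measure_ge0.
  have mGZ : measurable (G `&` Z) by exact: measurableI.
  pose H x := avg phi (fun x a => qt x a (G `&` Z)) x.
  have mH : measurable_fun setT H by apply: measurable_avg => //; exact: mqt.
  have H0 x : (0 <= H x)%E by exact: avg_ge0.
  have hH0 x : (0 <= hold x * H x)%E by rewrite mule_ge0.
  have mhH : measurable_fun setT (fun x => (hold x * H x)%E) by exact: emeasurable_funM.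
  rewrite /msum big_ord_recl.
  have step n : mphi_ n.+1 G = (\int[mphi_ n]_x (hold x * H x))%E.
    rewrite (mphiP n.+1).1// (jump_law_stationary mqt mqx qx0 qxbd qtT hphi hPphi)//.
    rewrite (mphiP n).2// (@restr n (fun x => (hold x * H x)%E))// => x nZ.
    by rewrite /H qtZ// mule0.
  have -> : (\sum_(i < k) mphi_ (lift ord0 i) G = \int[msum mphi_ k]_x (hold x * H x))%E.
    by rewrite ge0_integral_measure_sum//; apply: eq_bigr => i _; rewrite -step.
  have -> : Mpi G = (mpi 0%N G + \sum_(0 <= n <oo) mpi (n + 1)%N G)%E.
    rewrite (nneseries_addn (f := fun n => mpi n G))// -(@nneseries_recl _ xpredT)//.
  apply: leeD.
    rewrite (mphiP 0).1// (mpiP 0).1// !alive0 !setTI.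
    by case: hP => -> // _ _; case: hPphi => -> // _ _.
  apply: (@le_trans _ _ (\int[Mpi]_x (hold x * H x))%E).
    by apply: ge0_le_measure_integral.
  apply: le_trans (Mpi_hold H mH H0) _.
  (* Read backwards, the disintegration restores the actions of [p], and [jump_law] recognizes the
     integrated jump rates as the visits of [p] after the first. *)
  rewrite -(@expcost_disintegration (fun x a => qt x a (G `&` Z)))//; last exact: mqt.
  apply: (@le_trans _ _ (expcost P p (fun x a => qt x a (G `&` Z)))).
    apply: expcost_le => //.
    - by apply: measurable_on_Z; exact: mqt.
    - exact: mqt.
    - by apply: on_Z_ge0.
    - move=> x a; rewrite /on_Z indicE; case: (x \in Z); rewrite ?mul1e ?mul0e//.
  rewrite (expcost_sojourns mqx qx0 qxbd hp hP (mqt mGZ)) //.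
  rewrite le_eqVlt; apply/orP; left; apply/eqP.
  apply: eq_eseriesr => n _; rewrite addn1 (mpiP n.+1).1//.
  by rewrite (jump_law mqt mqx qx0 qxbd qtT hp hP).
have claimoo (G : set Sm) : measurable G -> (mseries mphi_ 0 G <= Mpi G)%E.
  move=> mG; rewrite /mseries; apply: lime_le; first exact: is_cvg_nneseries.
  by apply: nearW => k; have := claim k G mG; rewrite /msum big_mkord.
have ma := measurable_avg hphi mf f0.
have a0 x : (0 <= avg phi f x)%E by exact: avg_ge0.
have hf0 x : (0 <= hold x * avg phi f x)%E by rewrite mule_ge0.
have mhf : measurable_fun setT (fun x => (hold x * avg phi f x)%E) by exact: emeasurable_funM.
rewrite (expcost_stationary mqx qx0 qxbd hphi hPphi mf f0).
have -> : (\sum_(n <oo) \int[Pphi]_(w in alive n) (hold (X n w) * avg phi f (X n w)) =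
    \int[mseries mphi_ 0]_x (hold x * avg phi f x))%E.
  rewrite ge0_integral_measure_series//; apply: eq_eseriesr => n _.
  rewrite (mphiP n).2// (@restr n (fun x => (hold x * avg phi f x)%E))// => x nZ.
  by rewrite fZ// mule0.
apply: (@le_trans _ _ (\int[Mpi]_x (hold x * avg phi f x))%E).
  by apply: ge0_le_measure_integral.
apply: le_trans (Mpi_hold _ ma a0) _.
rewrite -(expcost_disintegration mf f0); apply: expcost_le.
- exact: measurable_on_Z.
- exact: mf.
- exact: on_Z_ge0.
- by move=> x a; rewrite /on_Z indicE; case: (x \in Z); rewrite ?mul1e ?mul0e.
Qed.

End comparison.

Theorem theorem6p1 (R : realType) (S A : ptopologicalType)
  (hS : borel_space R S) (hA : borel_space R A)
  (q : borel S -> borel A -> {charge set borel S -> \bar R})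
  (qt : borel S -> borel A -> {measure set borel S -> \bar R})
  (hqt : forall x a (G : set (borel S)), measurable G -> qt x a G = q x a (G `\ x))
  (hqS : forall x a, q x a setT = 0%E)
  (hqbd : forall x : S, exists M : R, forall a : A, qrate q x a <= M)
  (hqmeas : forall G : set (borel S), measurable G ->
     measurable_fun setT (fun xa : borel S * borel A => q xa.1 xa.2 G))
  (N : nat) (c : nat -> S -> A -> R) (d : nat -> R)
  (hc0 : forall i x a, (i <= N)%N -> 0 <= c i x a)
  (hcm : forall i, (i <= N)%N ->
     measurable_fun setT (fun xa : borel S * borel A => c i xa.1 xa.2))
  (hd : forall j, (1 <= j <= N)%N -> 0 <= d j)
  (C1a : compact [set: A])
  (C1b : forall f : S -> R, continuous f -> (exists M : R, forall y, `|f y| <= M) ->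
     continuous (fun xa : S * A =>
       fine (\int[qt xa.1 xa.2]_y (f y)%:E)%E / qrate q xa.1 xa.2))
  (C1c : continuous (fun xa : S * A => qrate q xa.1 xa.2))
  (C1d : forall i, (i <= N)%N -> lower_semicontinuous (fun xa : S * A => (c i xa.1 xa.2)%:E))
  (gam : {measure set borel S -> \bar R}) (hgam : gam setT = 1%E)
  (Pfam : policy R S A -> {measure set borel S -> \bar R} -> probability (Omega R S) R)
  (hP : forall (p : policy R S A) (g : {measure set borel S -> \bar R}), is_policy p -> g setT = 1%E -> strategic qt (qrate q) g p (Pfam p g))
  (fstar psistar : borel S -> borel A)
  (hfm : measurable_fun setT fstar)
  (hf : forall x, S2 q c N x -> \sum_(i < N.+1) c i x (fstar x) + qrate q x (fstar x) = 0)
  (hpsim : measurable_fun setT psistar)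
  (hpsi0 : forall x, ~ zeta Pfam c N x ->
     expcost (Pfam (det_stationary psistar) (\d_x : {measure set borel S -> \bar R}))
           (det_stationary psistar) (csum c N) = 0%E)
  (hpsiS2 : forall x, S2 q c N x -> psistar x = fstar x)
  (pi : policy R S A) (hpi : is_policy pi)
  (hfeas : forall j, (1 <= j <= N)%N -> (expcost (Pfam pi gam) pi (cE (c j)) <= (d j)%:E)%E)
  (hfin : (expcost (Pfam pi gam) pi (cE (c 0%N)) < +oo)%E)
  (hpiz : forall n w s, ~ zeta Pfam c N (X n w) ->
     forall U, pi n w s U = \d_(psistar (X n w)) U)
  (phi : borel S -> {measure set borel A -> \bar R}) (hphi : stoch_kernel phi)
  (hocc : forall G : set (borel S * borel A), measurable G ->
     G `<=` zeta Pfam c N `*` [set: borel A] ->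
     occ (Pfam pi gam) pi G = expcost (Pfam pi gam) pi (fun x _ => phi x (xsection G x)))
  (hphiz : forall x, ~ zeta Pfam c N x -> forall U, phi x U = \d_(psistar x) U) :
  forall i, (i <= N)%N ->
    (expcost (Pfam (stationary phi) gam) (stationary phi) (cE (c i))
      <= expcost (Pfam pi gam) pi (cE (c i)))%E.
Proof.
have mqx : measurable_fun setT (fun xa : borel S * borel A => qrate q xa.1 xa.2).
  exact: (continuous_borel_measurable2 hS hA C1c).
have qx0 := qrate_ge0 hS hqt hqS.
have qtT := qt_setT hS hqt hqS.
have mqt := measurable_qt hS hqt hqmeas mqx.
have mcE i : (i <= N)%N ->
    measurable_fun setT (fun xa : borel S * borel A => cE (c i) xa.1 xa.2).
  by move=> iN; apply/measurable_EFinP; exact: hcm.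
have cE0 i x a : (i <= N)%N -> (0 <= cE (c i) x a)%E.
  by move=> iN; rewrite lee_fin hc0.
have mcs : measurable_fun setT (fun xa : borel S * borel A => csum c N xa.1 xa.2).
  apply/measurable_EFinP; apply: measurable_sum => i.
  by apply: hcm; rewrite -ltnS.
have cs0 x a : (0 <= csum c N x a)%E.
  by rewrite lee_fin sumr_ge0// => i _; apply: hc0; rewrite -ltnS.
have cs_eq0 i x a : (i <= N)%N -> csum c N x a = 0%E -> c i x a = 0.
  move=> iN [] /eqP; rewrite psumr_eq0; last by move=> j _; apply: hc0; rewrite -ltnS.
  by move=> /allP /(_ (Ordinal (iN : (i < N.+1)%N))); rewrite mem_index_enum => /(_ isT)/eqP.
(* [V] replaces the infimum over deterministic Markov policies that defines [zeta]: the infimum is 0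
   exactly where [V] is, since [psistar] is one of these policies and costs nothing off [zeta]. *)
pose V := total_cost qt (qrate q) psistar (csum c N).
have mV : measurable_fun setT V.
  exact: (measurable_total_cost mqt mqx qx0 hqbd hpsim mcs cs0).
have hPpsi x : strategic qt (qrate q) (\d_x) (det_stationary psistar)
    (Pfam (det_stationary psistar) (\d_x : {measure set borel S -> \bar R})).
  by apply: hP; [case: (det_markov_det_stationary R hpsim)|exact: diracT].
have VE x : expcost (Pfam (det_stationary psistar) (\d_x : {measure set borel S -> \bar R}))
    (det_stationary psistar) (csum c N) = V x.
  exact: (expcost_det_stationary mqt mqx qx0 hqbd qtT hpsim mcs cs0 (hPpsi x)).
have zetaE x : zeta Pfam c N x <-> V x <> 0%E.
  split=> [zx V0|V0]; last by apply: contrapT => nz; apply: V0; rewrite -VE; exact: hpsi0.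
  move: zx; rewrite /zeta/= ltNge => /negP; apply; rewrite -V0 -VE.
  apply: ereal_inf_lbound; exists (det_stationary psistar) => //=.
  exact: det_markov_det_stationary.
have nzeta x : ~ zeta Pfam c N x -> V x = 0%E.
  by move=> nz; apply: contrapT => V0; apply: nz; exact/zetaE.
have zetaEset : zeta Pfam c N = [set x | V x <> 0%E].
  by apply/seteqP; split=> x /zetaE.
have mzeta : measurable (zeta Pfam c N).
  rewrite zetaEset (_ : [set _ | _] = setT `&` [set y | V y != 0%E]).
    exact: measurable_neqe.
  by rewrite setTI; apply/seteqP; split=> y /= /eqP.
have avgE f x : measurable_fun setT (fun xa : borel S * borel A => f xa.1 xa.2) ->
    ~ zeta Pfam c N x -> avg phi f x = f x (psistar x).
  move=> mf nz; rewrite -(avg_dirac psistar x mf).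
  by apply: eq_measure_integral => U mU _; exact: hphiz.
have active x : zeta Pfam c N x -> exists2 e : R, 0 < e &
    forall a, (e%:E <= (qrate q x a)%:E + csum c N x a)%E.
  move=> /zetaE Vx.
  pose inf := ereal_inf [set (qrate q x a + \sum_(i < N.+1) c i x a)%:E | a in [set: A]].
  have inf0 : (0 <= inf)%E.
    apply: le_ereal_inf_tmp => _ [a _ <-]; rewrite lee_fin addr_ge0//.
    by rewrite sumr_ge0// => i _; apply: hc0; rewrite -ltnS.
  have infn0 : inf != 0%E.
    (* On [S2] the map [psistar] equals [fstar], where cost and exit rate both vanish; then
       [V x = 0], contrary to x being in [zeta]. *)
    apply/eqP => i0; have S2x : S2 q c N x by [].
    apply: Vx; have := hf x S2x; rewrite -(hpsiS2 x S2x) => /eqP.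
    rewrite paddr_eq0//; last first.
      by rewrite sumr_ge0// => i _; apply: hc0; rewrite -ltnS.
    move=> /andP[/eqP cx /eqP qx].
    by rewrite /V; apply: total_cost_absorbing => //; rewrite /csum cx.
  have inffin : (inf < +oo)%E.
    apply: le_lt_trans (ltry (qrate q x point + \sum_(i < N.+1) c i x point)).
    by apply: ereal_inf_lbound; exists point.
  exists (fine inf).
    by rewrite fine_gt0// inffin andbT lt_neqAle eq_sym infn0.
  move=> a; rewrite fineK; last by rewrite ge0_fin_numE.
  by rewrite /csum -EFinD; apply: ereal_inf_lbound; exists a.
have exit x : ~ zeta Pfam c N x -> avg phi (fun x a => qt x a (zeta Pfam c N)) x = 0%E.
  move=> nz; rewrite avgE//; last exact: mqt.
  rewrite zetaEset /V; apply: total_cost0_closed => //; exact: nzeta.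
have hPpi := hP pi gam hpi hgam.
(* The objective is finite by [hfin], and every other cost is bounded by its constraint level. *)
have cfin : (expcost (Pfam pi gam) pi (csum c N) < +oo)%E.
  have [eta E] := occupation_measure_exists mqx qx0 hqbd hpi hPpi.
  rewrite E// /csum; under eq_integral do rewrite -sumEFin.
  rewrite ge0_integral_sum//; last 2 first.
  - by move=> i; apply: (mcE i); rewrite -ltnS.
  - by move=> i z _; apply: (cE0 i); rewrite -ltnS.
  apply: lte_sum_pinfty => i _.
  have iN : (i <= N)%N by rewrite -ltnS.
  rewrite -(E (cE (c i)) (mcE i iN)); last by move=> x a; exact: cE0.
  case: (posnP i) => [->//|i0].
  by apply: le_lt_trans (hfeas i _) (ltry _); rewrite i0.
have hPphi := hP (stationary phi) gam (is_policy_stationary hphi) hgam.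
move=> i iN.
apply: (expcost_comparison mqt mqx qx0 hqbd qtT hpi hPpi hphi hPphi mcs cs0 mzeta
  cfin active exit hocc (mcE i iN)).
- by move=> x a; exact: cE0.
(* Off [zeta] the total cost of [psistar] is 0, so the summed cost rate is 0 there, and hence each
   nonnegative summand. *)
- move=> x nz; rewrite (avgE _ _ (mcE i iN) nz) /cE; congr (_%:E).
  apply: cs_eq0 => //.
  exact: (total_cost0_cost mqx qx0 hqbd hpsim cs0 (nzeta x nz)).
Qed.
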